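(* Let $f:\mathbb{C}^{2}\to\mathbb{C}$ be a non-constant polynomial and let $\lambda_{0}\in\mathbb{C}$. Then $$\widetilde{\mathcal{L}}_{\infty,\lambda_{0}}(f)=\mathcal{L}_{\infty,\lambda_{0}}(f).$$
   Context: $\nabla f$ is the gradient (vector of partial derivatives) of $f$. For a polynomial mapping $F:\mathbb{C}^{n}\to\mathbb{C}^{m}$ ($n\geqslant2$) and an unbounded set $S\subset\mathbb{C}^{n}$ let $N(F|S):=\{\nu\in\mathbb{R}:\exists A,B>0\ \forall z\in S\ (|z|>B\Rightarrow|F(z)|\geqslant A|z|^{\nu})\}$, where $|\cdot|$ is the maximum norm; $\mathcal{L}_\infty(F|S):=\sup N(F|S)$ if $N(F|S)\neq\emptyset$ and $-\infty$ otherwise. For $\lambda_0\in\mathbb{C}$, $$\widetilde{\mathcal{L}}_{\infty,\lambda_{0}}(f):=\lim_{\delta\to0^{+}}\mathcal{L}_{\infty}(\nabla f|f^{-1}(D_{\delta})),\qquad D_{\delta}:=\{\lambda\in\mathbb{C}:|\lambda-\lambda_{0}|<\delta\}$$ (the limit always exists, possibly equal to $-\infty$, by monotonicity in $\delta$). A function meromorphic at infinity is given by a Laurent series $\sum_{m=k}^{-\infty}c_mt^m$, $k\in\mathbb{Z}$, convergent in a punctured neighbourhood of $\infty\in\overline{\mathbb{C}}$; its degree $\deg$ is the largest $m$ with $c_m\ne0$, $\deg 0:=-\infty$; for a tuple of such functions, $\deg$ is the maximum of the degrees of the components. For $\lambda\in\mathbb{C}$, $$\mathcal{L}_{\infty,\lambda}(f):=\inf_{\Phi}\frac{\deg(\nabla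 f\circ\Phi)}{\deg\Phi},$$ the infimum taken over all pairs $\Phi=(\varphi_1,\varphi_2)$ of functions meromorphic at infinity with $\deg\Phi>0$ and $\deg((f-\lambda)\circ\Phi)<0$. *)

(* Defs.v *)
From mathcomp Require Import all_boot all_order all_algebra complex.
From mathcomp Require Import all_classical all_reals all_analysis.

Set Implicit Arguments.
Unset Strict Implicit.
Unset Printing Implicit Defensive.

Import Order.TTheory GRing.Theory Num.Theory.
Import numFieldNormedType.Exports.

Local Open Scope classical_set_scope.
Local Open Scope ring_scope.
Local Open Scope complex_scope.

(* The modulus is taken real-valued ([normc]): MathComp's [`|z|] on [R[i]]
   lives in [R[i]], whereas [powR] needs a real base. *)
Definition maxnorm (R : realType) (n : nat) (z : 'rV[R[i]]_n) : R :=
  \big[Num.max/0]_(i < n) Normc.normc (z 0 i).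

Definition lojN (R : realType) (n m : nat)
    (F : 'rV[R[i]]_n -> 'rV[R[i]]_m) (S : set 'rV[R[i]]_n) : set R :=
  [set nu | exists A B : R, [/\ 0 < A, 0 < B &
     forall z, S z -> B < maxnorm z -> A * maxnorm z `^ nu <= maxnorm (F z)]].

(* [ereal_sup set0 = -oo] covers the case of an empty [lojN F S]. *)
Definition loj (R : realType) (n m : nat)
    (F : 'rV[R[i]]_n -> 'rV[R[i]]_m) (S : set 'rV[R[i]]_n) : \bar R :=
  ereal_sup [set nu%:E | nu in lojN F S].

(* Polynomials in C[x, y] are [{poly {poly R[i]}}]; as in [polyXY], the outer
   variable is x and the inner one is y, so the two partial derivatives are
   [f^`()] and the coefficientwise derivative. *)
Definition eval2 (R : realType) (f : {poly {poly R[i]}})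
    (z : 'rV[R[i]]_2) : R[i] :=
  f.[z 0 0, z 0 1].

Definition grad (R : realType) (f : {poly {poly R[i]}})
    (z : 'rV[R[i]]_2) : 'rV[R[i]]_2 :=
  \row_(i < 2) eval2 (if i == 0 then f^`() else map_poly deriv f) z.

Definition disc (R : realType) (l0 : R[i]) (delta : R) : set R[i] :=
  [set l | Normc.normc (l - l0) < delta].

Definition loj_near (R : realType) (f : {poly {poly R[i]}}) (l0 : R[i]) :
    \bar R :=
  lim (loj (grad f) (eval2 f @^-1` disc l0 delta) @[delta --> 0^'+]).

(* The Laurent series [sum_(m <= k) c_m t^m] converges to [phi t] for all large
   [t].  Functions meromorphic at infinity are represented by total functions
   on C of which only the germ at infinity matters. *)
Definition laurent_at_infty (R : realType) (phi : R[i] -> R[i])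
    (c : int -> R[i]) : Prop :=
  exists k : int, (forall m : int, k < m -> c m = 0) /\
  exists2 r : R, 0 < r & forall t : R[i], r < Normc.normc t ->
    (series (fun j : nat => c (k - j%:Z) * t ^ (k - j%:Z)) : nat -> R[i]^o)
      @ \oo --> (phi t : R[i]^o).

Definition meromorphic_at_infty (R : realType) (phi : R[i] -> R[i]) : Prop :=
  exists c, laurent_at_infty phi c.

(* The Laurent coefficients are determined by [phi], so for [phi] meromorphic
   at infinity this is the largest [m] with [c_m != 0], and [-oo] for the zero
   germ.  It is meaningful only for such [phi]. *)
Definition deg (R : realType) (phi : R[i] -> R[i]) : \bar R :=
  ereal_sup [set (m%:~R)%:E | m in
    [set m : int | exists2 c, laurent_at_infty phi c & c m != 0]].

Definition degv (R : realType) (n : nat) (Phi : R[i] -> 'rV[R[i]]_n) : \bar R :=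
  \big[Order.max/-oo%E]_(i < n) deg (fun t => Phi t 0 i).

Definition loj_param (R : realType) (f : {poly {poly R[i]}}) (l : R[i]) :
    \bar R :=
  ereal_inf [set (degv (grad f \o Phi) / degv Phi)%E | Phi in
    [set Phi : R[i] -> 'rV[R[i]]_2 |
      [/\ forall i, meromorphic_at_infty (fun t => Phi t 0 i),
          (0 < degv Phi)%E &
          (deg (fun t => eval2 f (Phi t) - l)%R < 0)%E]]].

(* Main.v *)
(* If Phi is a meromorphic curve with deg((f - lambda0) o Phi) < 0, then Phi(t)
   lies in f^-1(D_delta) for all large t, and comparing growth rates along Phi
   bounds every admissible exponent by deg(grad f o Phi) / deg Phi.

   Conversely, let nu be larger than the left-hand side.  There are points
   z = (x, y) -> oo with f(z) -> lambda0 and |grad f(z)| <= |z|^nu; by symmetry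
   |y| <= |x|.  For fixed x, move y to the nearest root w of the polynomial
   y (f - lambda0) f_x f_y (omitting vanishing factors): each factor g satisfies
   |g(x, w)| <= 2^deg |g(x, y)|, because the distance from w to any root of g is
   at most twice that from y.  The new points therefore satisfy the same
   estimates up to a constant, and they lie on an algebraic curve.  Infinitely
   many of them lie on a single Puiseux branch x = t^b, y = u(1/t) t^b, obtained
   by running the Newton polygon algorithm along the points; this branch is the
   required Phi.  Convergence is kept at each step: the only analytic input is
   the existence of a simple root of a polynomial whose coefficients are
   convergent power series, by a contraction in a weighted l^1-norm. *)
Require Import Defs.
From mathcomp Require Import all_boot all_order all_algebra complex.
From mathcomp Require Import all_classical all_reals all_analysis.
From mathcomp Require Import ring lra.
Set Implicit Arguments.
Unset Strict Implicit.
Unset Printing Implicit Defensive.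

Import Order.TTheory GRing.Theory Num.Theory.
Import numFieldNormedType.Exports.

Local Open Scope classical_set_scope.
Local Open Scope ring_scope.
Local Open Scope complex_scope.

(** * Complex modulus and convergence *)

Section Modulus.
Variable R : realType.
Local Notation C := R[i].
Local Notation normc := (@Normc.normc R).
Implicit Types x y z : C.

(** The curve is never factored into branches: the points choose. At each Newton step the rescaled
    points stay bounded and accumulate at some root of the edge polynomial, and only that root is
    pursued; the procedure ends because its multiplicity is smaller than the previous one.
    Analyticity is encoded by estimates for the norm sum |a_n| r^n. It is submultiplicative and
    complete, so products, limits, division by s and fixed points need no integration. The points
    give estimates along a sequence only, while degrees concern all large t. The gap is closed by
    rigidity: a germ meromorphic at infinity vanishes identically or is comparable to |t|^m for an
    integer m, so an inequality at arbitrarily large t already bounds m. Constants lost while moving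
    the points to the curve are harmless for the same reason. *)

Lemma normr_normc z : `|z| = (normc z)%:C.
Proof. by case: z. Qed.

Lemma normc_ge0 z : 0 <= normc z.
Proof. by case: z => a b; exact: sqrtr_ge0. Qed.

Lemma normc_eq0 z : (normc z == 0) = (z == 0).
Proof.
apply/eqP/eqP => [|->]; first exact: Normc.eq0_normc.
exact: Normc.normc0.
Qed.

Lemma normc_gt0 z : (0 < normc z) = (z != 0).
Proof. by rewrite lt_def normc_eq0 normc_ge0 andbT. Qed.

Lemma normcD_le x y : normc (x + y) <= normc x + normc y.
Proof. exact: (@le_normcD R). Qed.

Lemma normcN_eq x : normc (- x) = normc x.
Proof. exact: (@normcN R). Qed.

Lemma normc_distC x y : normc (x - y) = normc (y - x).
Proof. by rewrite -normcN_eq opprB. Qed.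

Lemma normcX z n : normc (z ^+ n) = normc z ^+ n.
Proof.
elim: n => [|n IHn]; first by rewrite !expr0 Normc.normc1.
by rewrite !exprS Normc.normcM IHn.
Qed.

Lemma normcXz z (n : int) : normc (z ^ n) = normc z ^ n.
Proof.
by case: n => n; rewrite /exprz ?Normc.normcV normcX.
Qed.

Lemma normc_real (a : R) : normc a%:C = `|a|.
Proof. by rewrite /Normc.normc /= expr0n addr0 sqrtr_sqr. Qed.

Lemma normc_sum (I : Type) (r : seq I) (P : pred I) (F : I -> C) :
  normc (\sum_(i <- r | P i) F i) <= \sum_(i <- r | P i) normc (F i).
Proof.
elim/big_ind2: _ => [|x1 x2 y1 y2 h1 h2|//]; first by rewrite Normc.normc0.
exact: le_trans (normcD_le _ _) (lerD h1 h2).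
Qed.

Lemma normc_le_dist x y : normc x - normc y <= normc (x - y).
Proof.
by rewrite lerBlDr; apply: le_trans (normcD_le _ _); rewrite subrK.
Qed.

Lemma normc_ge_Re z : `|complex.Re z| <= normc z.
Proof.
by case: z => a b /=; rewrite -sqrtr_sqr ler_wsqrtr // lerDl sqr_ge0.
Qed.

Lemma normc_ge_Im z : `|complex.Im z| <= normc z.
Proof.
by case: z => a b /=; rewrite -sqrtr_sqr ler_wsqrtr // lerDr sqr_ge0.
Qed.

Lemma normc_le_ReIm z : normc z <= `|complex.Re z| + `|complex.Im z|.
Proof.
case: z => a b /=.
rewrite -[leRHS]ger0_norm ?addr_ge0 // -sqrtr_sqr ler_wsqrtr //.
rewrite sqrrD !real_normK ?num_real // lerD2r lerDl.
by rewrite mulrn_wge0 // mulr_ge0.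
Qed.

(** Real tolerances match the real-valued modulus; [cvg_ccvg] identifies this notion with the
    topological limit in [laurent_at_infty]. *)
Definition ccvg (u : nat -> C) (l : C) : Prop :=
  forall e : R, 0 < e -> exists N, forall n, (N <= n)%N -> normc (u n - l) <= e.

Lemma ccvg_norm u l : ccvg u l -> (fun n => normc (u n)) @ \oo --> normc l.
Proof.
move=> ul; apply/cvgrPdist_le => e e0; have [N hN] := ul e e0.
exists N => // n /= /hN; apply: le_trans; rewrite ler_norml.
by rewrite lerNl opprB normc_le_dist normc_distC normc_le_dist.
Qed.

Lemma ccvgD u v l m : ccvg u l -> ccvg v m ->
  ccvg (fun n => u n + v n) (l + m).
Proof.
move=> ul vm e e0; have e20 : 0 < e / 2 by rewrite divr_gt0.
have [N hN] := ul _ e20; have [M hM] := vm _ e20.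
exists (maxn N M) => n; rewrite geq_max => /andP[/hN h1 /hM h2].
rewrite opprD addrACA (splitr e).
exact: le_trans (normcD_le _ _) (lerD h1 h2).
Qed.

Lemma ccvg_cst l : ccvg (fun=> l) l.
Proof. by move=> e e0; exists 0%N => n _; rewrite subrr Normc.normc0 ltW. Qed.

Lemma ccvgZ u l c : ccvg u l -> ccvg (fun n => c * u n) (c * l).
Proof.
move=> ul e e0; have c0 : 0 < normc c + 1 by rewrite ltr_wpDl ?normc_ge0.
have [N hN] := ul _ (divr_gt0 e0 c0).
exists N => n /hN h; rewrite -mulrBr Normc.normcM.
move: h; rewrite ler_pdivlMr // => h; apply: le_trans h.
by rewrite mulrC ler_wpM2l ?normc_ge0 // lerDl.
Qed.

Lemma ccvgB u v l m : ccvg u l -> ccvg v m ->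
  ccvg (fun n => u n - v n) (l - m).
Proof.
move=> ul /(ccvgZ (-1)) vm; have := ccvgD ul vm.
rewrite mulN1r; congr ccvg; apply/funext => n.
by rewrite mulN1r.
Qed.

Lemma ccvg_sum (I : Type) (r : seq I) (P : pred I) (u : I -> nat -> C) l :
  (forall i, ccvg (u i) (l i)) ->
  ccvg (fun n => \sum_(i <- r | P i) u i n) (\sum_(i <- r | P i) l i).
Proof.
move=> ul; elim: r => [|i r IHr].
  rewrite big_nil; have := @ccvg_cst 0; congr ccvg.
  by apply/funext => n; rewrite big_nil.
rewrite big_cons; set f := (X in ccvg X _).
have -> : f = fun n => if P i then u i n + \sum_(j <- r | P j) u j n
                       else \sum_(j <- r | P j) u j n.
  by apply/funext => n; rewrite /f big_cons.
by case: (P i) => //; apply: ccvgD.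
Qed.

Lemma ccvg_unique u l m : ccvg u l -> ccvg u m -> l = m.
Proof.
move=> ul um; apply/eqP; rewrite -subr_eq0 -normc_eq0.
rewrite eq_le normc_ge0 andbT; apply/ler_addgt0Pl => e e0; rewrite addr0.
have [N] := ccvgB ul um e0; move/(_ N (leqnn N)).
by rewrite subrr sub0r normcN_eq.
Qed.

Lemma real_series_cvg (u : nat -> R) (v : nat -> R) (M : R) :
  (forall n, `|u n| <= v n) -> (forall n, \sum_(i < n) v i <= M) ->
  exists l : R, series u @ \oo --> l.
Proof.
move=> uv vM.
have v0 n : 0 <= v n by apply: le_trans (uv n).
have cv : cvgn (series v).
  apply: nondecreasing_is_cvgn; first exact/nondecreasing_series.
  exists M => _ [n _ <-]; rewrite /series /= big_mkord; exact: vM.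
have : cvgn (series u).
  apply: normed_cvg; apply: series_le_cvg cv => // n /=; exact: normr_ge0.
by move=> h; exists (limn (series u)).
Qed.

(** Completeness is inherited from the reals: [v] dominates the real and the imaginary parts
    separately. *)
Lemma ccvg_series (u : nat -> C) (v : nat -> R) (M : R) :
  (forall n, normc (u n) <= v n) -> (forall n, \sum_(i < n) v i <= M) ->
  exists l, ccvg (fun n => \sum_(i < n) u i) l.
Proof.
move=> uv vM.
have [a ha] : exists l : R, series (fun n => complex.Re (u n)) @ \oo --> l.
  by apply: real_series_cvg vM => n; apply: le_trans (normc_ge_Re _) (uv n).
have [b hb] : exists l : R, series (fun n => complex.Im (u n)) @ \oo --> l.
  by apply: real_series_cvg vM => n; apply: le_trans (normc_ge_Im _) (uv n).
exists (a +i* b) => e e0; have e20 : 0 < e / 2 by rewrite divr_gt0.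
move/cvgrPdist_le: ha => /(_ _ e20) [N _ hN].
move/cvgrPdist_le: hb => /(_ _ e20) [K _ hK].
exists (maxn N K) => n; rewrite geq_max => /andP[/hN h1 /hK h2].
rewrite normc_distC; apply: le_trans (normc_le_ReIm _) _.
rewrite (splitr e); apply: lerD.
  move: h1; rewrite /series /= big_mkord; congr (`| _ | <= _).
  rewrite -(@big_morph _ _ (@complex.Re R) 0 +%R 0 +%R) //;
    last by case=> ? ? [].
  by case: (\sum_(i < n) _).
move: h2; rewrite /series /= big_mkord; congr (`| _ | <= _).
rewrite -(@big_morph _ _ (@complex.Im R) 0 +%R 0 +%R) //;
  last by case=> ? ? [].
by case: (\sum_(i < n) _).
Qed.

Lemma ccvg_geo (z : R) (u : nat -> C) l A : 0 <= z -> z < 1 ->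
  (forall n, normc (u n - l) <= A * z ^+ n) -> ccvg u l.
Proof.
move=> z0 z1 h e e0.
have : (fun n => A * z ^+ n) @ \oo --> A * 0.
  by apply: cvgMr; apply: cvg_expr; rewrite ger0_norm.
rewrite mulr0 => /cvgrPdist_le /(_ _ e0) [N _ hN]; exists N => n /hN.
rewrite sub0r normrN => h'; apply: le_trans (h n) (le_trans _ h').
exact: ler_norm.
Qed.

End Modulus.

(** * Power series with bounded weighted l^1-norm *)

Definition psum (K : comNzRingType) (a : nat -> K) (N : nat) (s : K) : K :=
  \sum_(i < N) a i * s ^+ i.

Lemma psumS (K : comNzRingType) (a : nat -> K) N s :
  psum a N.+1 s = psum a N s + a N * s ^+ N.
Proof. by rewrite /psum big_ord_recr. Qed.

Lemma psum0 (K : comNzRingType) (a : nat -> K) s : psum a 0 s = 0.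
Proof. by rewrite /psum big_ord0. Qed.

Lemma psum_monom (K : comNzRingType) (c : K) k N s :
  psum (fun i => if i == k then c else 0) N s =
  if (k < N)%N then c * s ^+ k else 0.
Proof.
elim: N => [|N IHN]; first by rewrite psum0.
rewrite psumS IHN ltnS [(k <= N)%N]leq_eqVlt [N == k]eq_sym.
have [->|] := eqVneq k N; first by rewrite ltnn add0r.
by rewrite mul0r addr0.
Qed.

Definition conv (K : comNzRingType) (a b : nat -> K) (n : nat) : K :=
  \sum_(i < n.+1) a i * b (n - i)%N.

(** The triangle i + j < N is summed by rows; each row has its own length [N - i], so this is not a
    product of two truncations. *)
Lemma psum_conv (K : comNzRingType) (a b : nat -> K) N s :
  psum (conv a b) N s = \sum_(i < N) a i * s ^+ i * psum b (N - i) s.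
Proof.
elim: N => [|N IHN]; first by rewrite psum0 big_ord0.
rewrite psumS IHN big_ord_recr /= subSnn psumS psum0 expr0 mulr1 add0r.
rewrite /conv big_ord_recr /= subnn mulrDl mulr_suml addrA.
congr (_ + _); last by rewrite -!mulrA [b _ * _]mulrC.
rewrite -big_split; apply: eq_bigr => i _ /=.
rewrite subSn ?(ltnW (ltn_ord i)) // psumS mulrDr; congr (_ + _).
rewrite -[in s ^+ N](subnKC (ltnW (ltn_ord i))) exprD.
by rewrite -!mulrA; congr (_ * _); rewrite mulrCA.
Qed.

Section BoundedPowerSeries.
Variable R : realType.
Local Notation C := R[i].
Local Notation normc := (@Normc.normc R).
Implicit Types (r M : R) (a b : nat -> C) (phi psi : C -> C) (s : C).

Local Notation nrm a := (fun i => normc (a i)).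

(* [phi] is the sum of [a_n s^n] and the l^1-norm [sum_n |a_n| r^n] is at most
   [M]; the right-hand side bounds the tail of the series from index [N]. *)
Definition bpsc r M a phi : Prop :=
  forall N s, normc s <= r ->
  r ^+ N * normc (phi s - psum a N s) <= normc s ^+ N * (M - psum (nrm a) N r).

Definition bps r M phi : Prop := exists a, bpsc r M a phi.

Lemma bpsc_ext r M a phi psi :
  (forall s, normc s <= r -> phi s = psi s) ->
  bpsc r M a phi -> bpsc r M a psi.
Proof. by move=> e h N s sr; rewrite -e //; apply: h. Qed.

Lemma bps_ext r M phi psi :
  (forall s, normc s <= r -> phi s = psi s) -> bps r M phi -> bps r M psi.
Proof. by move=> e [a h]; exists a; apply: bpsc_ext h. Qed.

(** At s = r the powers of [r] cancel, and the remainder on the left is nonnegative. *)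
Lemma bpsc_psum_le r M a phi N : 0 < r ->
  bpsc r M a phi -> psum (nrm a) N r <= M.
Proof.
move=> r0 h; have := h N r%:C; rewrite normc_real (ger0_norm (ltW r0)) =>
  /(_ (lexx _)).
rewrite ler_pM2l ?exprn_gt0 // => /(le_trans (normc_ge0 _)).
by rewrite subr_ge0.
Qed.

Lemma bpsc_coef_le r M a phi n : 0 < r ->
  bpsc r M a phi -> normc (a n) * r ^+ n <= M.
Proof.
move=> r0 /(bpsc_psum_le n.+1 r0); apply: le_trans.
rewrite psumS lerDr; apply: sumr_ge0 => i _.
by rewrite mulr_ge0 ?normc_ge0 // exprn_ge0 // ltW.
Qed.

Lemma bps_bound r M phi s : bps r M phi -> normc s <= r -> normc (phi s) <= M.
Proof.
case=> a h sr; have := h 0%N s sr.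
by rewrite !psum0 !expr0 !mul1r !subr0.
Qed.

Lemma bps_ge0 r M phi : 0 < r -> bps r M phi -> 0 <= M.
Proof.
move=> r0 h; apply: le_trans (normc_ge0 _) (bps_bound (s := 0) h _).
by rewrite Normc.normc0 ltW.
Qed.

Lemma bpsc_coef0 r M a phi : 0 < r -> bpsc r M a phi -> a 0%N = phi 0.
Proof.
move=> r0 h; have := h 1%N 0; rewrite Normc.normc0 => /(_ (ltW r0)).
rewrite psumS psum0 expr0 mulr1 add0r !expr1 mul0r pmulr_rle0 // => h'.
have : normc (phi 0 - a 0%N) == 0 by rewrite eq_le h' normc_ge0.
by rewrite normc_eq0 subr_eq0 => /eqP.
Qed.

Lemma bpsc_ge r M M' a phi : M <= M' -> bpsc r M a phi -> bpsc r M' a phi.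
Proof.
move=> MM h N s sr; apply: le_trans (h N s sr) _.
by rewrite ler_wpM2l ?exprn_ge0 ?normc_ge0 // lerD2r.
Qed.

Lemma bps_ge r M M' phi : M <= M' -> bps r M phi -> bps r M' phi.
Proof. by move=> MM [a h]; exists a; apply: bpsc_ge h. Qed.

Lemma bpsc_monom r c k : 0 < r ->
  bpsc r (normc c * r ^+ k) (fun i => if i == k then c else 0)
    (fun s => c * s ^+ k).
Proof.
move=> r0 N s sr; rewrite psum_monom.
set f := (fun i => normc _).
have -> : f = fun i => if i == k then normc c else 0.
  by apply/funext => i; rewrite /f; case: eqP => // _; rewrite Normc.normc0.
rewrite psum_monom; case: ltnP => kN; first by rewrite !subrr Normc.normc0 !mulr0.
rewrite !subr0 Normc.normcM normcX !(mulrCA _ (normc c)).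
rewrite ler_wpM2l ?normc_ge0 // -(subnKC kN) !exprD mulrCA.
rewrite ler_wpM2l ?exprn_ge0 ?normc_ge0 //.
by rewrite ler_wpM2l ?exprn_ge0 ?(ltW r0) // lerXn2r // nnegrE ?normc_ge0 // ltW.
Qed.

Lemma bps_cst r c : 0 < r -> bps r (normc c) (fun=> c).
Proof.
move=> r0; have := bpsc_monom c 0 r0; rewrite expr0 mulr1.
move=> h; exists (fun i => if i == 0%N then c else 0).
by apply: bpsc_ext h => s _; rewrite mulr1.
Qed.

Lemma bps_id r : 0 < r -> bps r r id.
Proof.
move=> r0; have := bpsc_monom 1 1 r0; rewrite expr1 Normc.normc1 mul1r.
move=> h; exists (fun i => if i == 1%N then 1 else 0).
by apply: bpsc_ext h => s _; rewrite mul1r.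
Qed.

Lemma bpsD r M M' phi psi : 0 < r -> bps r M phi -> bps r M' psi ->
  bps r (M + M') (fun s => phi s + psi s).
Proof.
move=> r0 [a ha] [b hb]; exists (fun i => a i + b i) => N s sr.
have -> : psum (fun i => a i + b i) N s = psum a N s + psum b N s.
  by rewrite /psum -big_split; apply: eq_bigr => i _; rewrite mulrDl.
rewrite opprD addrACA.
apply: (@le_trans _ _ (normc s ^+ N *
  ((M - psum (nrm a) N r) + (M' - psum (nrm b) N r)))).
  rewrite mulrDr; apply: le_trans (lerD (ha N s sr) (hb N s sr)).
  by rewrite -mulrDr ler_wpM2l ?normcD_le // exprn_ge0 // ltW.
rewrite ler_wpM2l ?exprn_ge0 ?normc_ge0 // addrACA lerD2l -opprD lerN2.
rewrite /psum -big_split; apply: ler_sum => i _ /=.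
by rewrite -mulrDl ler_wpM2r ?normcD_le // exprn_ge0 // ltW.
Qed.

(** Submultiplicativity of the l^1-norm. The remainder of the product and the defect M M' - S split
    in the same way: a_i s^i times a remainder of [psi], summed over i < N, plus a remainder of
    [phi] times [psi]. Corresponding terms are compared. *)
Lemma bpsM r M M' phi psi : 0 < r -> bps r M phi -> bps r M' psi ->
  bps r (M * M') (fun s => phi s * psi s).
Proof.
move=> r0 hphi hpsi; have M'0 := bps_ge0 r0 hpsi.
case: (hphi) => a ha; case: (hpsi) => b hb.
exists (conv a b) => N s sr.
have rp n : 0 <= r ^+ n by rewrite exprn_ge0 // ltW.
have sp n : 0 <= normc s ^+ n by rewrite exprn_ge0 // normc_ge0.
set A' := psum (nrm a) N r; set S := \sum_(i < N) normc (a i) * r ^+ i * psum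
  (nrm b) (N - i) r.
apply: (@le_trans _ _ (normc s ^+ N * (M * M' - S))); last first.
  rewrite ler_wpM2l // lerD2l lerN2 /S -(psum_conv (nrm a) (nrm b)).
  apply: ler_sum => i _; rewrite ler_wpM2r //.
  apply: le_trans (normc_sum _ _ _) _.
  by apply: ler_sum => j _; rewrite Normc.normcM.
have -> : phi s * psi s - psum (conv a b) N s =
   \sum_(i < N) a i * s ^+ i * (psi s - psum b (N - i) s)
   + (phi s - psum a N s) * psi s.
  rewrite psum_conv.
  under [X in _ = X + _]eq_bigr do rewrite mulrBr.
  by rewrite sumrB -mulr_suml -/(psum a N s); ring.
have -> : M * M' - S = \sum_(i < N) normc (a i) * r ^+ i * (M' - psum (nrm b)
  (N - i) r)
   + (M - A') * M'.
  under [X in _ = X + _]eq_bigr do rewrite mulrBr.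
  rewrite sumrB -mulr_suml -/S.
  have -> : \sum_(i < N) normc (a i) * r ^+ i = A' by [].
  by ring.
apply: le_trans (ler_wpM2l (rp N) (normcD_le _ _)) _.
rewrite !mulrDr; apply: lerD; last first.
  rewrite Normc.normcM !mulrA; apply: ler_pM;
    rewrite ?normc_ge0 ?mulr_ge0 ?normc_ge0 //.
    exact: ha.
  exact: bps_bound sr.
apply: le_trans (ler_wpM2l (rp N) (normc_sum _ _ _)) _.
rewrite !mulr_sumr; apply: ler_sum => i _.
have iN : (i <= N)%N by apply: ltnW.
rewrite !Normc.normcM normcX mulrCA -!mulrA [leRHS]mulrCA ler_wpM2l ?normc_ge0 //.
have := hb (N - i)%N s sr => /(ler_wpM2l (mulr_ge0 (rp i) (sp i))).
have -> : r ^+ N = r ^+ i * r ^+ (N - i) by rewrite -exprD subnKC.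
have -> : normc s ^+ N = normc s ^+ i * normc s ^+ (N - i).
  by rewrite -exprD subnKC.
by congr (_ <= _); ring.
Qed.

Lemma bpsX r M phi n : 0 < r -> bps r M phi -> bps r (M ^+ n) (fun s => phi s ^+ n).
Proof.
move=> r0 h; elim: n => [|n IHn].
  by rewrite expr0 -(Normc.normc1 R); exact: bps_cst.
rewrite exprS; apply: bps_ext (bpsM r0 h IHn) => s _.
by rewrite exprS.
Qed.

Lemma bpsN r M phi : 0 < r -> bps r M phi -> bps r M (fun s => - phi s).
Proof.
move=> r0 /(bpsM r0 (bps_cst (-1) r0)).
rewrite normcN_eq Normc.normc1 mul1r; apply: bps_ext => s _.
by rewrite mulN1r.
Qed.

Lemma bps_sum r n (M : 'I_n -> R) (phi : 'I_n -> C -> C) : 0 < r ->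
  (forall i, bps r (M i) (phi i)) ->
  bps r (\sum_i M i) (fun s => \sum_i phi i s).
Proof.
move=> r0; elim: n M phi => [|n IHn] M phi h.
  rewrite big_ord0 -(Normc.normc0 R); apply: bps_ext (bps_cst 0 r0) => s _.
  by rewrite big_ord0.
rewrite big_ord_recl.
apply: (bps_ext (phi := fun s => phi ord0 s + \sum_(i < n) phi (lift ord0 i) s)).
  by move=> s _; rewrite big_ord_recl.
by apply: bpsD => //; apply: IHn.
Qed.

Lemma bpsc_shrink r r' M a phi : 0 < r' -> r' <= r ->
  bpsc r M a phi -> bpsc r' M a phi.
Proof.
move=> r'0 rr h N s sr; have r0 := lt_le_trans r'0 rr.
have := h N s (le_trans sr rr).
set A := psum (nrm a) N r; set A' := psum (nrm a) N r'.
have hA : 0 <= M - A by rewrite subr_ge0; apply: bpsc_psum_le h.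
have AA : A' <= A.
  apply: ler_sum => i _; rewrite ler_wpM2l ?normc_ge0 //.
  by rewrite lerXn2r // nnegrE ltW.
have /= rho : (r' / r) ^+ N <= 1.
  by apply: exprn_ile1; rewrite ?divr_ge0 ?(ltW r0) ?(ltW r'0) //
    ler_pdivrMr // mul1r.
have rho0 : 0 <= (r' / r) ^+ N by rewrite exprn_ge0 // divr_ge0 ?ltW.
move=> /(ler_wpM2l rho0); rewrite mulrA -exprMn divfK ?gt_eqF // => h'.
apply: le_trans h' _; rewrite mulrCA ler_wpM2l ?exprn_ge0 ?normc_ge0 //.
apply: le_trans (ler_wpM2r hA rho) _.
by rewrite mul1r lerD2l lerN2.
Qed.

Lemma bps_shrink r r' M phi : 0 < r' -> r' <= r -> bps r M phi -> bps r' M phi.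
Proof. by move=> h1 h2 [a h]; exists a; apply: bpsc_shrink h. Qed.

(** Every exponent drops by one, which divides the norm by [r]; the value [a 1] at 0 is the one that
    the shifted expansion prescribes. *)
Lemma bpsc_div r M a phi : 0 < r -> a 0%N = 0 -> bpsc r M a phi ->
  bpsc r (M / r) (fun i => a i.+1) (fun s => if s == 0 then a 1%N else phi s / s).
Proof.
move=> r0 a0 h.
have psh (K : comNzRingType) (c : nat -> K) N t : c 0%N = 0 ->
    psum c N.+1 t = t * psum (fun i => c i.+1) N t.
  move=> c0; rewrite /psum big_ord_recl c0 mul0r add0r mulr_sumr.
  by apply: eq_bigr => i _; rewrite lift0 exprS mulrCA.
have psh' N t : psum (nrm a) N.+1 t = t * psum (nrm (fun i => a i.+1)) N t.
  by apply: psh; rewrite a0 Normc.normc0.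
move=> N s sr.
have -> : M / r - psum (nrm (fun i => a i.+1)) N r = (M - psum (nrm a) N.+1 r) / r.
  by rewrite psh' mulrBl mulrAC divff ?gt_eqF // mul1r.
have [->|s0] := eqVneq s 0.
  rewrite Normc.normc0; case: N => [|N].
    rewrite psum0 !expr0 subr0 !mul1r psumS psum0 expr0 a0 Normc.normc0 mul0r.
    rewrite addr0 subr0 ler_pdivlMr //; have := bpsc_coef_le 1 r0 h.
    by rewrite expr1.
  have -> : psum (fun i => a i.+1) N.+1 0 = a 1%N.
    rewrite /psum big_ord_recl expr0 mulr1 big1 ?addr0 // => i _.
    by rewrite expr0n mulr0.
  by rewrite subrr Normc.normc0 mulr0 expr0n /= mul0r.
have := h N.+1 s sr; rewrite psh // !exprS.
have -> : phi s - s * psum (fun i => a i.+1) N s =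
          s * (phi s / s - psum (fun i => a i.+1) N s).
  by rewrite mulrBr mulrCA divff // mulr1.
have s0' : 0 < normc s by rewrite normc_gt0.
rewrite Normc.normcM; set X := normc (_ - _); set Y := M - _.
have -> : r * r ^+ N * (normc s * X) = normc s * (r * (r ^+ N * X)) by ring.
by rewrite -mulrA ler_pM2l // => h'; rewrite [leRHS]mulrA ler_pdivlMr // mulrC.
Qed.

Lemma bps_div r M phi : 0 < r -> phi 0 = 0 -> bps r M phi ->
  exists2 psi, bps r (M / r) psi & forall s, phi s = s * psi s.
Proof.
move=> r0 p0 [a h]; have a0 : a 0%N = 0 by rewrite (bpsc_coef0 r0 h).
exists (fun s => if s == 0 then a 1%N else phi s / s).
  by exists (fun i => a i.+1); apply: bpsc_div.
move=> s; have [->|s0] := eqVneq s 0; first by rewrite mul0r.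
by rewrite mulrCA divff // mulr1.
Qed.

(** The factor s split off from [phi] has norm r' on the smaller disc. Germs vanishing at 0 thus get
    arbitrarily small norm, the source of continuity and of the contraction constants. *)
Lemma bps_small r r' M phi : 0 < r' -> r' <= r -> phi 0 = 0 -> bps r M phi ->
  bps r' (r' * (M / r)) phi.
Proof.
move=> r'0 rr p0 h; have r0 := lt_le_trans r'0 rr.
have [psi hpsi e] := bps_div r0 p0 h.
apply: (bps_ext (phi := fun s => s * psi s)) => [s _|]; first by rewrite -e.
by apply: bpsM => //; [exact: bps_id | exact: bps_shrink hpsi].
Qed.

(** The remainder estimates add up over k, and being weak inequalities between continuous
    expressions they survive the limit. *)
Lemma bpsc_series r M (Mk : nat -> R) (ak : nat -> nat -> C) (phik : nat -> C -> C)
    a phi : 0 < r ->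
  (forall k, bpsc r (Mk k) (ak k) (phik k)) ->
  (forall K, \sum_(k < K) Mk k <= M) ->
  (forall n, ccvg (fun K => \sum_(k < K) ak k n) (a n)) ->
  (forall s, normc s <= r -> ccvg (fun K => \sum_(k < K) phik k s) (phi s)) ->
  bpsc r M a phi.
Proof.
move=> r0 hk hM ha hphi N s sr.
pose u K := \sum_(k < K) phik k s - psum (fun n => \sum_(k < K) ak k n) N s.
have hu : ccvg u (phi s - psum a N s).
  apply: ccvgB; first exact: hphi.
  rewrite /psum; apply: ccvg_sum => i.
  have := ccvgZ (s ^+ i) (ha i); rewrite mulrC; congr ccvg.
  by apply/funext => K; rewrite mulrC.
have h1 : (fun K => r ^+ N * normc (u K)) @ \oo -->
          r ^+ N * normc (phi s - psum a N s).
  by apply: cvgMr; apply: ccvg_norm.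
pose v K := psum (nrm (fun n => \sum_(k < K) ak k n)) N r.
have h2 : (fun K => normc s ^+ N * (M - v K)) @ \oo -->
          normc s ^+ N * (M - psum (nrm a) N r).
  apply: cvgMr; apply: cvgB; first exact: cvg_cst.
  rewrite /v; elim: {1 2}N => [|n IHn].
    under eq_fun do rewrite psum0.
    by rewrite psum0; exact: cvg_cst.
  under eq_fun do rewrite psumS.
  rewrite psumS; apply: cvgD => //; apply: cvgMl.
  exact: ccvg_norm.
apply: ler_cvg_to h1 h2 _; near=> K.
have -> : u K = \sum_(k < K) (phik k s - psum (ak k) N s).
  rewrite /u sumrB; congr (_ - _); rewrite /psum exchange_big /=.
  by apply: eq_bigr => i _; rewrite mulr_suml.
apply: le_trans (ler_wpM2l _ (normc_sum _ _ _)) _.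
  by rewrite exprn_ge0 // ltW.
rewrite mulr_sumr.
apply: (@le_trans _ _ (\sum_(k < K) normc s ^+ N * (Mk k - psum (nrm (ak k)) N r))).
  by apply: ler_sum => k _; apply: hk.
rewrite -mulr_sumr ler_wpM2l ?exprn_ge0 ?normc_ge0 // sumrB.
apply: lerB; first exact: hM.
rewrite /v /psum exchange_big /=; apply: ler_sum => i _.
by rewrite -mulr_suml ler_wpM2r ?normc_sum // exprn_ge0 // ltW.
Unshelve. all: by end_near.
Qed.

(** The coefficients converge automatically, since the n-th coefficient of [phik k] is at most Mk /
    r^n; only pointwise convergence has to be supplied. *)
Lemma bps_series r M (Mk : nat -> R) (phik : nat -> C -> C) phi : 0 < r ->
  (forall k, bps r (Mk k) (phik k)) ->
  (forall K, \sum_(k < K) Mk k <= M) ->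
  (forall s, normc s <= r -> ccvg (fun K => \sum_(k < K) phik k s) (phi s)) ->
  bps r M phi.
Proof.
move=> r0 /choice[ak hk] hM hphi.
have /choice[a ha] n : exists l, ccvg (fun K => \sum_(k < K) ak k n) l.
  apply: (ccvg_series (u := fun k => ak k n) (v := fun k =>
    Mk k / r ^+ n) (M := M / r ^+ n)) => [k|K].
    by rewrite ler_pdivlMr ?exprn_gt0 //; apply: bpsc_coef_le (hk k).
  by rewrite -mulr_suml ler_wpM2r // invr_ge0 exprn_ge0 // ltW.
by exists a; apply: bpsc_series hk hM ha hphi.
Qed.

End BoundedPowerSeries.

(** * Analytic germs at 0 *)

Section AnalyticGerms.
Variable R : realType.
Local Notation C := R[i].
Local Notation normc := (@Normc.normc R).
Implicit Types (r M e : R) (phi psi : C -> C) (s : C) (P : C -> {poly C}).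

(** The ball contains its centre, so an identity holding near 0 may be evaluated at 0. *)
Definition near0 (Q : C -> Prop) : Prop :=
  exists2 e : R, 0 < e & forall s, normc s <= e -> Q s.

Lemma near0_and (Q1 Q2 : C -> Prop) : near0 Q1 -> near0 Q2 ->
  near0 (fun s => Q1 s /\ Q2 s).
Proof.
move=> [e1 e10 h1] [e2 e20 h2]; exists (Num.min e1 e2).
  by rewrite lt_min e10.
by move=> s; rewrite le_min => /andP[/h1 ? /h2 ?].
Qed.

Lemma near0_sub (Q1 Q2 : C -> Prop) : (forall s, Q1 s -> Q2 s) ->
  near0 Q1 -> near0 Q2.
Proof. by move=> h [e e0 h1]; exists e => // s /h1 /h. Qed.

Lemma near0_forall (n : nat) (Q : nat -> C -> Prop) :
  (forall i, (i < n)%N -> near0 (Q i)) ->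
  near0 (fun s => forall i, (i < n)%N -> Q i s).
Proof.
elim: n => [|n IHn] h; first by exists 1.
have h1 := h n (ltnSn n).
have := near0_and h1 (IHn (fun i ni => h i (ltnW ni))).
apply: near0_sub => s [q1 q2] i; rewrite ltnS leq_eqVlt.
by case: eqVneq => [->//|_ /=]; apply: q2.
Qed.

Definition analytic0 phi : Prop := exists r M, 0 < r /\ bps r M phi.

Lemma analytic0_ext phi psi : near0 (fun s => phi s = psi s) ->
  analytic0 phi -> analytic0 psi.
Proof.
move=> [e e0 he] [r [M [r0 h]]]; exists (Num.min e r), M.
rewrite lt_min e0 r0; split=> //.
apply: (bps_ext (phi := phi)).
  by move=> s; rewrite le_min => /andP[/he].
apply: bps_shrink h; first by rewrite lt_min e0.
by rewrite ge_min lexx orbT.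
Qed.

Lemma analytic0_common phi psi : analytic0 phi -> analytic0 psi ->
  exists r M, [/\ 0 < r, bps r M phi & bps r M psi].
Proof.
move=> [r [M [r0 h]]] [r' [M' [r'0 h']]].
exists (Num.min r r'), (Num.max M M'); split; first by rewrite lt_min r0.
  apply: bps_ge (bps_shrink _ _ h); rewrite ?le_max ?lexx // ?lt_min ?r0 //.
  by rewrite ge_min lexx.
apply: bps_ge (bps_shrink _ _ h'); rewrite ?le_max ?lexx ?orbT // ?lt_min ?r0 //.
by rewrite ge_min lexx orbT.
Qed.

Lemma analytic0_cst c : analytic0 (fun=> c).
Proof. by exists 1, (normc c); split=> //; apply: bps_cst. Qed.

Lemma analytic0_id : analytic0 id.
Proof. by exists 1, 1; split=> //; apply: bps_id. Qed.

Lemma analytic0D phi psi : analytic0 phi -> analytic0 psi ->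
  analytic0 (fun s => phi s + psi s).
Proof.
move=> h /(analytic0_common h)[r [M [r0 h1 h2]]]; exists r, (M + M); split=> //.
exact: bpsD.
Qed.

Lemma analytic0M phi psi : analytic0 phi -> analytic0 psi ->
  analytic0 (fun s => phi s * psi s).
Proof.
move=> h /(analytic0_common h)[r [M [r0 h1 h2]]]; exists r, (M * M); split=> //.
exact: bpsM.
Qed.

Lemma analytic0N phi : analytic0 phi -> analytic0 (fun s => - phi s).
Proof. by move=> [r [M [r0 h]]]; exists r, M; split=> //; apply: bpsN. Qed.

Lemma analytic0B phi psi : analytic0 phi -> analytic0 psi ->
  analytic0 (fun s => phi s - psi s).
Proof. by move=> h1 h2; apply: analytic0D => //; apply: analytic0N. Qed.

Lemma analytic0X phi n : analytic0 phi -> analytic0 (fun s => phi s ^+ n).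
Proof. by move=> [r [M [r0 h]]]; exists r, (M ^+ n); split=> //; apply: bpsX. Qed.

Lemma analytic0_sum (I : Type) (l : seq I) (p : pred I) (F : I -> C -> C) :
  (forall i, p i -> analytic0 (F i)) -> analytic0 (fun s =>
    \sum_(i <- l | p i) F i s).
Proof.
move=> h; elim: l => [|i l IHl].
  by under eq_fun do rewrite big_nil; exact: analytic0_cst.
under eq_fun do rewrite big_cons.
by case pi: (p i) => //; apply: analytic0D => //; apply: h.
Qed.

Lemma analytic0_bounded phi : analytic0 phi -> exists M, near0 (fun s =>
  normc (phi s) <= M).
Proof.
move=> [r [M [r0 h]]]; exists M, r => // s sr; exact: bps_bound h sr.
Qed.

Lemma analytic0_cont phi e : analytic0 phi -> 0 < e ->
  near0 (fun s => normc (phi s - phi 0) <= e).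
Proof.
move=> h e0; have : analytic0 (fun s => phi s - phi 0) by apply: analytic0B =>
  //; exact: analytic0_cst.
move=> [r [M [r0 hr]]].
have M0 := bps_ge0 r0 hr.
have h1 : 0 < M / r + 1 by rewrite ltr_wpDl ?divr_ge0 // ltW.
pose r' := Num.min r (e / (M / r + 1)).
have r'0 : 0 < r' by rewrite lt_min r0 divr_gt0.
exists r' => // s sr.
have := bps_small r'0 _ (subrr _) hr; rewrite ge_min lexx => /(_ isT) h2.
apply: le_trans (bps_bound h2 sr) _.
have : r' <= e / (M / r + 1) by rewrite ge_min lexx orbT.
rewrite ler_pdivlMr //; apply: le_trans.
by rewrite ler_wpM2l ?(ltW r'0) // lerDl.
Qed.

Lemma analytic0_neq0 phi : analytic0 phi -> phi 0 != 0 ->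
  near0 (fun s => normc (phi 0) / 2 <= normc (phi s)).
Proof.
move=> h p0; have n0 : 0 < normc (phi 0) by rewrite normc_gt0.
apply: near0_sub (analytic0_cont h (divr_gt0 n0 (ltr0Sn _ 1))) => s.
rewrite normc_distC => h1; have := le_trans (normc_le_dist _ _) h1.
lra.
Qed.

Lemma bpsc_geo r M (a : nat -> C) phi s N : 0 < r -> bpsc r M a phi ->
  normc s <= r -> normc (phi s - psum a N s) <= M * (normc s / r) ^+ N.
Proof.
move=> r0 h sr; have := h N s sr.
rewrite mulrC -ler_pdivlMr ?exprn_gt0 // => h'; apply: le_trans h' _.
rewrite mulrAC expr_div_n mulrC ler_wpM2r //.
  by rewrite divr_ge0 ?exprn_ge0 ?normc_ge0 // ltW.
rewrite gerDl oppr_le0; apply: sumr_ge0 => i _.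
by rewrite mulr_ge0 ?normc_ge0 // exprn_ge0 // ltW.
Qed.

Lemma bpsc_cvg r M (a : nat -> C) phi s : 0 < r -> bpsc r M a phi ->
  normc s < r -> ccvg (fun N => psum a N s) (phi s).
Proof.
move=> r0 h sr; apply: (@ccvg_geo _ (normc s / r) _ _ M).
- by rewrite divr_ge0 ?normc_ge0 // ltW.
- by rewrite ltr_pdivrMr // mul1r.
- by move=> n; rewrite normc_distC; apply: bpsc_geo (ltW sr).
Qed.

Lemma analytic0_comp_exp phi b : (0 < b)%N -> analytic0 phi ->
  analytic0 (fun s => phi (s ^+ b)).
Proof.
move=> b0 [r [M [r0 [a h]]]].
(* Since r' <= 1, r'^b <= r' <= r/2, strictly inside the disc where the series is known to
   converge. *)
pose r' := Num.min 1 (r / 2).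
have r20 : 0 < r / 2 by rewrite divr_gt0.
have r'0 : 0 < r' by rewrite lt_min ltr01.
have r'b : r' ^+ b <= r / 2.
  apply: le_trans (_ : r' <= _); last by rewrite ge_min lexx orbT.
  rewrite -[leRHS]expr1; apply: ler_wiXn2l => //; first exact: ltW.
  by rewrite ge_min lexx.
have rr : r / 2 < r by lra.
exists r', M; split=> //.
apply: (bps_series (Mk := fun k => normc (a k) * (r' ^+ b) ^+ k)
                   (phik := fun k s => a k * (s ^+ b) ^+ k)) => // [k|K|s sr].
- exists (fun i => if i == (b * k)%N then a k else 0).
  have := bpsc_monom (a k) (b * k) r'0; rewrite exprM.
  by apply: bpsc_ext => s _; rewrite exprM.
- apply: le_trans (bpsc_psum_le K r0 h); apply: ler_sum => i _.
  rewrite ler_wpM2l ?normc_ge0 //; apply: lerXn2r; rewrite ?nnegrE.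
  + by rewrite exprn_ge0 // ltW.
  + exact: ltW.
  + exact: le_trans r'b (ltW rr).
- apply: (bpsc_cvg r0 h); apply: le_lt_trans rr; rewrite normcX.
  by apply: le_trans r'b; apply: lerXn2r; rewrite ?nnegrE ?normc_ge0 ?(ltW r'0).
Qed.

Lemma bpsc_eq0 r M (a : nat -> C) phi s : 0 < r -> bpsc r M a phi ->
  (forall n, a n = 0) -> normc s < r -> phi s = 0.
Proof.
move=> r0 h a0 sr; apply: ccvg_unique (bpsc_cvg r0 h sr) _.
have -> : (fun N => psum a N s) = fun=> 0; last exact: ccvg_cst.
by apply/funext => N; rewrite /psum big1 // => i _; rewrite a0 mul0r.
Qed.

(** While the constant coefficient is 0, division by s lowers the index of a known nonzero
    coefficient; the induction on that index stops at the order of vanishing. *)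
Lemma bpsc_order r M (a : nat -> C) phi : 0 < r -> bpsc r M a phi ->
  (exists n, a n != 0) -> exists k u, [/\ a k != 0, forall i, (i < k)%N -> a i = 0,
    analytic0 u, u 0 = a k & forall s, phi s = s ^+ k * u s].
Proof.
move=> r0 h [n an]; elim: n a M phi h an => [|n IHn] a M phi h an.
  exists 0%N, phi; split=> //; last by move=> s; rewrite mul1r.
  - by exists r, M; split=> //; exists a.
  - by rewrite (bpsc_coef0 r0 h).
have [a0|a0] := eqVneq (a 0%N) 0; last first.
  exists 0%N, phi; split=> //; last by move=> s; rewrite mul1r.
  - by exists r, M; split=> //; exists a.
  - by rewrite (bpsc_coef0 r0 h).
have := bpsc_div r0 a0 h; move=> /IHn /(_ an)[k [u [ak a_lt ua u0 ku]]].
exists k.+1, u; split=> //; first by move=> [|i] // /a_lt.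
move=> s; rewrite exprS -mulrA -ku; have [->|s0] := eqVneq s 0.
  by rewrite mul0r -(bpsc_coef0 r0 h) a0.
by rewrite mulrCA divff // mulr1.
Qed.

Lemma analytic0_order phi : analytic0 phi -> near0 (fun s => phi s = 0) \/
  exists k u, [/\ analytic0 u, u 0 != 0 & near0 (fun s => phi s = s ^+ k * u s)].
Proof.
move=> [r [M [r0 [a h]]]].
case: (pselect (exists n, a n != 0)) => [an|a0].
  have [k [u [ak _ ua u0 ku]]] := bpsc_order r0 h an.
  by right; exists k, u; split; rewrite ?u0 //; exists 1.
left; exists (r / 2); first by rewrite divr_gt0.
move=> s sr; apply: (bpsc_eq0 r0 h); last by apply: le_lt_trans sr _; lra.
by move=> n; apply/eqP/negPn/negP => an; apply: a0; exists n.
Qed.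

Lemma analytic0_family (n : nat) (f : nat -> C -> C) :
  (forall i, (i < n)%N -> analytic0 (f i)) ->
  exists r M, 0 < r /\ forall i, (i < n)%N -> bps r M (f i).
Proof.
elim: n => [|n IHn] h; first by exists 1, 0.
have [r [M [r0 hr]]] := IHn (fun i ni => h i (ltnW ni)).
have [r' [M' [r'0 hr']]] := h n (ltnSn n).
exists (Num.min r r'), (Num.max M M'); split; first by rewrite lt_min r0.
move=> i; rewrite ltnS leq_eqVlt => /predU1P[->|/hr].
  apply: bps_ge (bps_shrink _ _ hr'); rewrite ?le_max ?lexx ?orbT // ?lt_min ?r0 //.
  by rewrite ge_min lexx orbT.
move=> hi; apply: bps_ge (bps_shrink _ _ hi); rewrite ?le_max ?lexx //
  ?lt_min ?r0 //.
by rewrite ge_min lexx.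
Qed.

End AnalyticGerms.

(** * Simple roots of polynomials with analytic coefficients *)

Section AnalyticFamilies.
Variable R : realType.
Local Notation C := R[i].
Local Notation normc := (@Normc.normc R).
Implicit Types (r M e : R) (phi psi : C -> C) (s : C) (P : C -> {poly C}).

(** The size is only bounded: leading coefficients may vanish, in particular at s = 0, where roots
    escape to infinity. *)
Definition analytic_poly (n : nat) P : Prop :=
  (forall s, (size (P s) <= n)%N) /\ forall i, analytic0 (fun s => (P s)`_i).

(** Exponents at least 2 gain a factor [eta], which makes the nonlinear terms contracting on a small
    ball. The recursion is u^(m+1) - v^(m+1) = u (u^m - v^m) + (u - v) v^m. *)
Lemma bps_subX r (eta d : R) (u v : C -> C) n : 0 < r -> eta <= 1 ->
  bps r eta u -> bps r eta v -> bps r d (fun s => u s - v s) ->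
  bps r (n.+2%:R * eta * d) (fun s => u s ^+ n.+2 - v s ^+ n.+2).
Proof.
move=> r0 eta1 hu hv hd.
have eta0 := bps_ge0 r0 hu; have d0 := bps_ge0 r0 hd.
have step m A : bps r A (fun s => u s ^+ m - v s ^+ m) ->
    bps r (eta * A + d * eta ^+ m) (fun s => u s ^+ m.+1 - v s ^+ m.+1).
  move=> hA; apply: bps_ext (bpsD r0 (bpsM r0 hu hA) (bpsM r0 hd (bpsX m r0 hv))).
  by move=> s _; rewrite !exprS; ring.
elim: n => [|n IHn].
  have /step : bps r d (fun s => u s ^+ 1 - v s ^+ 1).
    by apply: bps_ext hd => s _; rewrite !expr1.
  by apply: bps_ge; rewrite expr1; lra.
apply: bps_ge (step _ _ IHn).
have h1 : eta * (n.+2%:R * eta * d) <= n.+2%:R * eta * d.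
  by rewrite ler_piMl // !mulr_ge0.
have h2 : d * eta ^+ n.+2 <= eta * d.
  by rewrite mulrC ler_wpM2r // exprS ler_piMr // exprn_ile1.
rewrite -[n.+3%:R]natr1; move: (n.+2%:R : R) h1 => x h1.
by rewrite !mulrDl mul1r; apply: lerD.
Qed.

(** Banach's iteration from 0. The k-th step has norm at most eta/2 times 2^-k, so the k-th iterate
    has norm at most eta (1 - 2^-k) and stays in the ball where [lip] applies; the limit is the sum
    of the telescoping series of steps. *)
Lemma contraction_fixpoint r (eta : R) (F : C -> C -> C) :
  0 < r -> 0 < eta ->
  bps r (eta / 2) (fun s => F s 0) -> F 0 0 = 0 ->
  (forall u v d, bps r eta u -> bps r eta v -> bps r d (fun s => u s - v s) ->
     bps r (d / 2) (fun s => F s (u s) - F s (v s))) ->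
  exists tau, [/\ bps r eta tau, tau 0 = 0 &
    forall s, normc s <= r -> F s (tau s) = tau s].
Proof.
move=> r0 eta0 F0 F00 lip.
pose tau k := iter k (fun (u : C -> C) s => F s (u s)) (fun=> 0).
have tauS k s : tau k.+1 s = F s (tau k s) by [].
have c0 : bps r 0 (fun=> 0 : C) by rewrite -(Normc.normc0 R); apply: bps_cst.
have htau k : bps r (eta * (1 - 2^-1 ^+ k)) (tau k) /\
    bps r (eta / 2 * 2^-1 ^+ k) (fun s => tau k.+1 s - tau k s).
  elim: k => [|k [IH1 IH2]].
    rewrite expr0 subrr mulr0 mulr1; split=> //.
    by apply: bps_ext F0 => s _; rewrite subr0.
  have p0 m : 0 <= 2^-1 ^+ m :> R by rewrite exprn_ge0 // invr_ge0.
  have hk1 : bps r (eta * (1 - 2^-1 ^+ k.+1)) (tau k.+1).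
    apply: (bps_ext (phi := fun s => tau k s + (tau k.+1 s - tau k s))).
      by move=> s _; rewrite addrC subrK.
    apply: bps_ge (bpsD r0 IH1 IH2).
    by rewrite exprS; set x := 2^-1 ^+ k; lra.
  split=> //.
  rewrite exprS mulrA (mulrAC _ _ (2^-1 ^+ k)); apply: lip => //.
    by apply: bps_ge hk1; rewrite ger_pMr // gerBl.
  by apply: bps_ge IH1; rewrite ger_pMr // gerBl.
have telesc K s : \sum_(k < K) (tau k.+1 s - tau k s) = tau K s.
  elim: K => [|K IHK]; first by rewrite big_ord0.
  by rewrite big_ord_recr IHK /= addrC subrK.
have sumM K : \sum_(k < K) eta / 2 * 2^-1 ^+ k <= eta.
  have -> : \sum_(k < K) eta / 2 * 2^-1 ^+ k = eta * (1 - 2^-1 ^+ K).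
    elim: K => [|K IHK]; first by rewrite big_ord0 expr0 subrr mulr0.
    by rewrite big_ord_recr IHK /= exprS; set x := 2^-1 ^+ K; lra.
  by rewrite ger_pMr // gerBl exprn_ge0 // invr_ge0.
have /choice[t ht] s : exists l, normc s <= r -> ccvg (fun K => tau K s) l.
  case: (leP (normc s) r) => sr; last by exists 0.
  have [l hl] := ccvg_series (u := fun k => tau k.+1 s - tau k s)
    (fun k => bps_bound (htau k).2 sr) sumM.
  by exists l => _; move: hl; congr ccvg; apply/funext => K; rewrite telesc.
have bt : bps r eta t.
  apply: (bps_series r0 (fun k => (htau k).2)) => // s /ht.
  by congr ccvg; apply/funext => K; rewrite telesc.
exists t; split=> //.
  have := ht 0; rewrite Normc.normc0 => /(_ (ltW r0)) h.
  apply: ccvg_unique h _.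
  have -> : (fun K => tau K 0) = fun=> 0; last exact: ccvg_cst.
  by apply/funext; elim=> [|k IHk] //; rewrite tauS IHk.
move=> s sr; apply: (@ccvg_unique _ (fun K => tau K.+1 s)); last first.
  by move=> e /(ht s sr)[N hN]; exists N => n Nn; apply: hN; apply: leqW.
move=> e e0; have [N hN] := ht s sr e e0.
exists N => n Nn; rewrite tauS.
(* Applied to constant functions, [lip] becomes a Lipschitz bound for [F s] at the single point
   s. *)
have cst_le u : bps r eta u -> bps r eta (fun=> u s).
  by move=> /bps_bound /(_ sr) h; apply: bps_ge (bps_cst _ r0).
have h1 : bps r eta (tau n).
  by apply: bps_ge (htau n).1; rewrite ger_pMr // gerBl.
have := lip _ _ _ (cst_le _ h1) (cst_le _ bt) (bps_cst (tau n s - t s) r0).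
move=> /bps_bound /(_ sr) h; apply: le_trans h _.
have := hN n Nn; have := normc_ge0 (tau n s - t s); lra.
Qed.

(** Newton's iteration with frozen slope [k]: in y - P(s, y) / k the coefficients of degree 0 and 1
    vanish at s = 0, hence are small on a small disc, and the higher powers of y contract by
    [bps_subX]. *)
Lemma analytic_simple_root n P : analytic_poly n P -> (P 0)`_0 = 0 ->
  (P 0)`_1 != 0 ->
  exists tau, [/\ analytic0 tau, tau 0 = 0 & near0 (fun s => (P s).[tau s] = 0)].
Proof.
move=> [szP hP] P00 P01; set k := (P 0)`_1.
pose f i s := ('X - k^-1 *: P s)`_i.
have hf i : analytic0 (f i).
  apply: (analytic0_ext (phi := fun s => ('X`_i - k^-1 * (P s)`_i))).
    by exists 1 => // s _; rewrite /f coefB coefZ.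
  by apply: analytic0B; [exact: analytic0_cst|apply: analytic0M => //;
    exact: analytic0_cst].
pose F s y := \sum_(i < n.+2) f i s * y ^+ i.
have FE s y : F s y = y - k^-1 * (P s).[y].
  rewrite /F -horner_coef_wide ?hornerE //.
  rewrite (leq_trans (size_polyD _ _)) // size_polyX size_polyN geq_max /=.
  rewrite (leq_trans (size_scale_leq _ _)) //.
  exact: leq_trans (szP s) (leq_trans (leqnSn _) (leqnSn _)).
have f00 : f 0%N 0 = 0 by rewrite /f coefB coefZ coefX P00 mulr0 subrr.
have f10 : f 1%N 0 = 0 by rewrite /f coefB coefZ coefX mulVf // subrr.
have [r0 [M [r00 hM]]] := analytic0_family (n := n.+2) (fun i _ => hf i).
have M0 : 0 <= M by apply: bps_ge0 r00 (hM 0%N _).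
(* With eta = 1/A the terms of degree at least 2 contribute at most d/4 to the Lipschitz estimate;
   the linear term contributes another d/4. *)
pose A := (n.+2%:R * n.+2%:R * M * 4%:R + 1 : R).
have A1 : 1 <= A by rewrite lerDr !mulr_ge0.
have A0 : 0 < A by apply: lt_le_trans A1.
pose eta := A^-1.
have eta0 : 0 < eta by rewrite invr_gt0.
have eta1 : eta <= 1 by rewrite invf_le1.
(* This radius makes the bound of [bps_small] equal to (eta/4) M / (M+1), so [f 0] and [f 1] have
   norm at most eta/4. *)
pose r := r0 * (eta / 4 / (M + 1)).
have M1 : 0 < M + 1 by rewrite ltr_wpDl.
have r_gt0 : 0 < r by rewrite mulr_gt0 // !divr_gt0.
have rr : r <= r0.
  rewrite ger_pMr // ler_pdivrMr // mul1r; lra.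
have hsmall i : (i < 2)%N -> bps r (eta / 4) (f i).
  move=> i2; have fi0 : f i 0 = 0 by case: i i2 => [|[|]].
  apply: bps_ge (bps_small r_gt0 rr fi0 (hM i (leq_trans i2 _))) => //.
  have -> : r * (M / r0) = eta / 4 * (M / (M + 1)).
    rewrite /r; field; rewrite !gt_eqF //=.
  rewrite ger_pMr ?divr_gt0 // ler_pdivrMr // mul1r; lra.
have hr i : (i < n.+2)%N -> bps r M (f i) by move=> /hM; apply: bps_shrink.
have [|||tau [h1 h2 h3]] := @contraction_fixpoint r eta F r_gt0 eta0.
- apply: (@bps_ge _ _ (eta / 4)); first lra.
  apply: bps_ext (hsmall 0%N isT) => s _.
  rewrite /F big_ord_recl expr0 mulr1 big1 ?addr0 // => i _.
  by rewrite lift0 expr0n mulr0.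
- rewrite /F big_ord_recl expr0 mulr1 f00 big1 ?addr0 // => i _.
  by rewrite lift0 expr0n mulr0.
- move=> u v d hu hv hd; have d0 := bps_ge0 r_gt0 hd.
  apply: (bps_ext (phi := fun s => f 1%N s * (u s - v s) +
     \sum_(i < n) f i.+2 s * (u s ^+ i.+2 - v s ^+ i.+2))).
    move=> s _; rewrite /F -sumrB !big_ord_recl !expr0 subrr add0r /=.
    rewrite !expr1 -mulrBr; congr (_ + _).
    by apply: eq_bigr => i _; rewrite mulrBr.
  have hs : bps r (\sum_(i < n) M * (n.+2%:R * eta * d))
       (fun s => \sum_(i < n) f i.+2 s * (u s ^+ i.+2 - v s ^+ i.+2)).
    apply: (bps_sum r_gt0) => i; apply: bpsM => //; first by apply: hr;
      rewrite !ltnS.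
    apply: bps_ge (bps_subX i r_gt0 eta1 hu hv hd).
    rewrite !ler_wpM2r ?(ltW eta0) // ler_nat.
    by rewrite !ltnS ltnW.
  apply: bps_ge (bpsD r_gt0 (bpsM r_gt0 (hsmall 1%N isT) hd) hs).
  rewrite sumr_const card_ord -[_ *+ n]mulr_natl.
  have h1 : eta * d <= d by apply: ler_piMl.
  have h2 : n%:R * (M * (n.+2%:R * eta * d)) <= d / 4; last lra.
  have -> : n%:R * (M * (n.+2%:R * eta * d)) = (n%:R * n.+2%:R * M * 4) * eta *
    (d / 4).
    by field.
  rewrite ler_piMl ?divr_ge0 // ler_pdivrMr // mul1r /A ler_wpDr //.
  rewrite !ler_wpM2r // ler_nat.
  by apply: leq_trans (leqnSn _) (leqnSn _).
exists tau; split=> //; first by exists r, eta.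
exists r => // s /h3; rewrite FE => /eqP.
rewrite -subr_eq0 addrAC subrr add0r oppr_eq0 mulf_eq0 invr_eq0 (negbTE P01) /=.
by move/eqP.
Qed.

End AnalyticFamilies.

(** * Newton polygon *)

Section PolynomialFamilies.
Variable R : realType.
Local Notation C := R[i].
Local Notation normc := (@Normc.normc R).
Implicit Types (r M e : R) (phi psi : C -> C) (s c : C) (P : C -> {poly C}).

(** The Taylor expansion at [c], with a fixed length and divided derivatives, so that its
    coefficients remain analytic when [p] and [c] depend on s. *)
Definition shiftp (n : nat) (p : {poly C}) (c : C) : {poly C} :=
  \poly_(i < n) (p^`N(i)).[c].

Lemma horner_shiftp n (p : {poly C}) c y : (size p <= n)%N ->
  (shiftp n p c).[y] = p.[c + y].
Proof.
move=> np; rewrite horner_poly (nderiv_taylor_wide _ np) //.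
exact: mulrC.
Qed.

Lemma coef_shiftp n (p : {poly C}) c i : (size p <= n)%N ->
  (shiftp n p c)`_i = (p^`N(i)).[c].
Proof.
move=> np; rewrite coef_poly; case: ltnP => // ni.
by rewrite nderivn_poly0 ?horner0 // (leq_trans np ni).
Qed.

Lemma coef_shiftp0 n (p : {poly C}) i : (size p <= n)%N ->
  (shiftp n p 0)`_i = p`_i.
Proof. by move=> np; rewrite coef_shiftp //
  horner_coef0 coef_nderivn addn0 binn. Qed.

Lemma analytic_poly_horner n P phi : analytic_poly n P -> analytic0 phi ->
  analytic0 (fun s => (P s).[phi s]).
Proof.
move=> [szP hP] hphi.
apply: (analytic0_ext (phi := fun s => \sum_(i < n) (P s)`_i * phi s ^+ i)).
  by exists 1 => // s _; rewrite -horner_coef_wide.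
by apply: analytic0_sum => i _; apply: analytic0M => //; apply: analytic0X.
Qed.

Lemma analytic_poly_nderiv n P k : analytic_poly n P ->
  analytic_poly n (fun s => (P s)^`N(k)).
Proof.
move=> [szP hP]; split=> [s|i].
  apply/leq_sizeP => j nj; rewrite coef_nderivn nth_default ?mul0rn //.
  by rewrite (leq_trans (szP s)) // (leq_trans nj) // leq_addl.
apply: (analytic0_ext (phi := fun s => 'C(k + i, k)%:R * (P s)`_(k + i))).
  by exists 1 => // s _; rewrite coef_nderivn mulr_natl.
by apply: analytic0M => //; exact: analytic0_cst.
Qed.

Lemma analytic_poly_shiftp n P tau : analytic_poly n P -> analytic0 tau ->
  analytic_poly n (fun s => shiftp n (P s) (tau s)).
Proof.
move=> hP htau; split=> [s|i]; first exact: size_poly.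
apply: (analytic0_ext (phi := fun s => ((P s)^`N(i)).[tau s])).
  by exists 1 => // s _; rewrite coef_shiftp //; apply: hP.1.
exact: analytic_poly_horner (analytic_poly_nderiv i hP) htau.
Qed.

Lemma analytic_poly_bounded n P : analytic_poly n P ->
  exists2 M, 0 <= M & near0 (fun s => forall i, normc (P s)`_i <= M).
Proof.
move=> [szP hP]; have [r [M [r0 h]]] := analytic0_family (n := n) (fun i _ => hP i).
exists (Num.max M 0); first by rewrite le_max lexx orbT.
exists r => // s sr i; rewrite le_max; case: (ltnP i n) => ni.
  by rewrite (bps_bound (h i ni) sr).
by rewrite nth_default ?Normc.normc0 ?lexx ?orbT // (leq_trans (szP s)).
Qed.

(** For small y the constant term dominates, so P is a unit near (0, 0). This settles multiplicity 0
    and controls the cofactor of y^(m+1) in the Newton step. *)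
Lemma analytic_poly_nonvanish n P : analytic_poly n P -> (P 0)`_0 != 0 ->
  exists e (c : R), [/\ 0 < e, 0 < c &
    forall s y, normc s <= e -> normc y <= e -> c <= normc (P s).[y]].
Proof.
move=> hP P0; have [M M0 hM] := analytic_poly_bounded hP.
have [e e0 he] := near0_and hM (analytic0_neq0 (hP.2 0%N) P0).
set d := normc (P 0)`_0; have d0 : 0 < d by rewrite normc_gt0.
have A0 : 0 < n%:R * M * 4 + 1 by rewrite ltr_wpDl // !mulr_ge0.
exists (Num.min e (Num.min 1 (d / (n%:R * M * 4 + 1)))), (d / 4); split.
- by rewrite !lt_min e0 ltr01 divr_gt0.
- by rewrite divr_gt0.
move=> s y; rewrite !le_min => /and3P[/he[h1 h2] _ _] /and3P[_ y1 yd].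
have -> : (P s).[y] = (P s)`_0 - (- ((P s).[y] - (P s)`_0)) by ring.
apply: le_trans (normc_le_dist _ _); rewrite normcN_eq.
suff : normc ((P s).[y] - (P s)`_0) <= d / 4 by move: h2; rewrite -/d; lra.
have -> : (P s).[y] - (P s)`_0 = \sum_(i < n) (P s)`_i.+1 * y ^+ i.+1.
  rewrite (horner_coef_wide _ (leq_trans (hP.1 s) (leqnSn n))).
  by rewrite big_ord_recl expr0 mulr1 addrAC subrr add0r.
apply: le_trans (normc_sum _ _ _) _.
apply: (@le_trans _ _ (\sum_(i < n) M * normc y)).
  apply: ler_sum => i _; rewrite Normc.normcM normcX.
  apply: ler_pM; rewrite ?normc_ge0 ?exprn_ge0 ?normc_ge0 //
    exprS ler_piMr ?normc_ge0 //.
  by rewrite exprn_ile1 ?normc_ge0.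
rewrite sumr_const card_ord -[_ *+ n]mulr_natl mulrA.
move: yd; rewrite ler_pdivlMr // => yd.
have := normc_ge0 y; move: yd; set x := n%:R * M; nra.
Qed.

Lemma horner_prod_ge (rs : seq C) (w : C) e : 0 <= e ->
  (forall z, z \in rs -> e <= normc (w - z)) ->
  e ^+ size rs <= normc (\prod_(z <- rs) ('X - z%:P)).[w].
Proof.
move=> e0; elim: rs => [|z rs IH] h; first by rewrite big_nil hornerC Normc.normc1.
rewrite big_cons hornerM !hornerE Normc.normcM /= exprS.
apply: ler_pM; rewrite ?exprn_ge0 //; first by apply: h; rewrite mem_head.
by apply: IH => x xr; apply: h; rewrite inE xr orbT.
Qed.

(* [E e] is the set of points admissible at precision [e]: quantifying over [e]
   replaces the extraction of subsequences. *)
Lemma cluster_root n P (E : R -> C -> C -> Prop) (e0 B : R) :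
  analytic_poly n P -> P 0 != 0 ->
  (forall e e' s y, e <= e' -> E e s y -> E e' s y) ->
  0 < e0 ->
  (forall e s y, E e s y -> s != 0 -> normc s <= e0 -> normc y <= B ->
     (P s).[y] = 0) ->
  (forall e, 0 < e -> exists s y, [/\ E e s y, s != 0,
    normc s <= e & normc y <= B]) ->
  exists c, forall e, 0 < e ->
    exists s y, [/\ E e s y, s != 0, normc s <= e & normc (y - c) <= e].
Proof.
move=> hP P0 mE e00 hE appE.
have [rs Prs] := closed_field_poly_normal (P 0).
have l0 : lead_coef (P 0) != 0 by rewrite lead_coef_eq0.
apply: contrapT => /forallNP noc.
(* If no root of [P 0] were a cluster point, one radius e1 would keep the admissible points away
   from all of the finitely many roots, so |P(0, y)| >= k. But P(s, y) = 0, and [d] below is chosen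
   so that the variation of the coefficients allows at most k/2. *)
have [e1 e10 he1] : exists2 e1, 0 < e1 & forall z, z \in rs -> forall s y,
    E e1 s y -> s != 0 -> normc s <= e1 -> e1 < normc (y - z).
  elim: (rs) => [|z l [e1 e10 IH]]; first by exists 1.
  have /existsNP[e2 /not_implyP[e20 h2]] := noc z.
  exists (Num.min e1 e2); first by rewrite lt_min e10.
  move=> x; rewrite inE => /predU1P[->|/IH{}IH] s y Es s0; rewrite le_min =>
    /andP[s1 s2].
    rewrite ltNge; apply/negP => yz; apply: h2; exists s, y; split=> //.
      by apply: mE Es; rewrite ge_min lexx orbT.
    by apply: le_trans yz _; rewrite ge_min lexx orbT.
  apply: le_lt_trans (IH s y _ s0 s1); first by rewrite ge_min lexx.
  by apply: mE Es; rewrite ge_min lexx.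
pose k := normc (lead_coef (P 0)) * e1 ^+ size rs.
have k0 : 0 < k by rewrite mulr_gt0 ?normc_gt0 // exprn_gt0.
have B0 : 0 <= B.
  by have [s [y [_ _ _]]] := appE _ e10; apply: le_trans; apply: normc_ge0.
pose S := \sum_(i < n) B ^+ i.
have S0 : 0 <= S by apply: sumr_ge0 => i _; rewrite exprn_ge0.
pose d := k / (2 * (S + 1)).
have S1 : 0 < S + 1 by rewrite ltr_wpDl.
have d0 : 0 < d by rewrite divr_gt0 // mulr_gt0.
have [e2 e20 he2] := near0_forall (n := n) (fun i _ => analytic0_cont (hP.2 i) d0).
pose e3 := Num.min e0 (Num.min e1 e2).
have e30 : 0 < e3 by rewrite !lt_min e00 e10.
have [s [y [Es s0 sle yB]]] := appE _ e30.
move: sle; rewrite !le_min => /and3P[se0 se1 se2].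
have Ps := hE _ _ _ Es s0 se0 yB.
have Es1 : E e1 s y by apply: mE Es; rewrite !ge_min lexx orbT.
have : k <= normc (P 0).[y].
  rewrite Prs hornerZ Normc.normcM ler_wpM2l ?normc_ge0 //.
  apply: horner_prod_ge => [|z zrs]; first exact: ltW.
  by apply: ltW; apply: he1 Es1 s0 se1.
suff : normc (P 0).[y] <= k / 2 by lra.
have -> : (P 0).[y] = - ((P s).[y] - (P 0).[y]) by rewrite Ps; ring.
rewrite normcN_eq !(horner_coef_wide _ (hP.1 _)) -sumrB.
apply: le_trans (normc_sum _ _ _) _.
apply: (@le_trans _ _ (\sum_(i < n) d * B ^+ i)).
  apply: ler_sum => i _; rewrite -mulrBl Normc.normcM normcX.
  apply: ler_pM; rewrite ?normc_ge0 ?exprn_ge0 ?normc_ge0 //; first exact: he2.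
  by rewrite lerXn2r // nnegrE normc_ge0.
rewrite -mulr_sumr -/S /d.
have -> : k / (2 * (S + 1)) * S = k / 2 * (S / (S + 1)).
  by field; rewrite gt_eqF.
rewrite ler_piMr ?divr_ge0 ?(ltW k0) // ler_pdivrMr // mul1r lerDl //.
Qed.

(** The least v i / (m - i) is the slope of the Newton edge ending at degree m; cross-multiplication
    keeps the inequality in the natural numbers. *)
Lemma argmin_ratio (m : nat) (v : nat -> nat) (Z : nat -> Prop) i1 :
  (i1 < m)%N -> Z i1 ->
  exists i0, [/\ (i0 < m)%N, Z i0 &
    forall i, (i < m)%N -> Z i -> (v i0 * (m - i) <= v i * (m - i0))%N].
Proof.
move=> i1m Zi1.
have h1 : [pred i : 'I_m | `[< Z i >]] (Ordinal i1m) by apply/asboolP.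
case: (arg_minP (fun i : 'I_m => (v i)%:R / (m - i)%:R : R) h1) =>
  i0 /asboolP Zi0 hmin.
exists i0; split=> // i im Zi.
have /hmin : [pred i : 'I_m | `[< Z i >]] (Ordinal im) by apply/asboolP.
rewrite /= ler_pdivlMr ?ltr0n ?subn_gt0 // mulrAC ler_pdivrMr ?ltr0n ?subn_gt0 //.
by rewrite -!natrM ler_nat.
Qed.

(* Newton polygon: [a / b] is the slope of its first edge, [i0] an exponent on
   that edge, and the [psi_i] are the coefficients after s = sigma^b,
   y = sigma^a w and division by sigma^(a m). *)
Lemma newton_polygon (m : nat) (q : nat -> C -> C) i1 :
  (forall i, analytic0 (q i)) -> (forall i, (i < m)%N -> q i 0 = 0) ->
  (i1 < m)%N -> ~ near0 (fun s => q i1 s = 0) ->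
  exists a b i0 (psi : nat -> C -> C), [/\ (0 < a)%N && (0 < b)%N, (i0 < m)%N,
    (forall i, analytic0 (psi i) /\
       near0 (fun s => q i (s ^+ b) * s ^+ (a * i) = s ^+ (a * m) * psi i s)),
    psi i0 0 != 0 &
    (forall i, (m <= i)%N -> psi i = fun s => q i (s ^+ b) * s ^+ (a * (i - m))) /\
    (forall i, (i < m)%N -> near0 (fun s => q i s = 0) -> psi i = fun=> 0)].
Proof.
move=> hq q0 i1m Z1; pose Z i := ~ near0 (fun s => q i s = 0).
have /choice[v hv] i : exists v, Z i -> exists u,
    [/\ analytic0 u, u 0 != 0 & near0 (fun s => q i s = s ^+ v * u s)].
  case: (analytic0_order (hq i)) => [h|[k [u hu]]]; first by exists 0%N => /(_ h).
  by exists k => _; exists u.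
have [i0 [i0m Zi0 hmin]] := @argmin_ratio m v Z i1 i1m Z1.
pose a := v i0; pose b := (m - i0)%N.
have b0 : (0 < b)%N by rewrite subn_gt0.
(* Order 0 would make q_(i0) a unit, whereas it vanishes at 0. *)
have a0 : (0 < a)%N.
  have [u [_ u0 [e e0 /(_ 0)]]] := hv i0 Zi0.
  rewrite Normc.normc0 q0 // => /(_ (ltW e0)) /esym.
  by rewrite /a; case: (v i0) => //; rewrite expr0 mul1r => h; rewrite h eqxx in u0.
have near_exp (Q : C -> Prop) : near0 Q -> near0 (fun s => Q (s ^+ b)).
  move=> [e e0 h]; exists (Num.min 1 e); first by rewrite lt_min ltr01.
  move=> s; rewrite le_min => /andP[s1 se]; apply: h; rewrite normcX.
  apply: le_trans se; rewrite -[leRHS]expr1.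
  by apply: ler_wiXn2l => //; exact: normc_ge0.
have /choice[psi hpsi] i : exists psi, [/\ analytic0 psi,
    near0 (fun s => q i (s ^+ b) * s ^+ (a * i) = s ^+ (a * m) * psi s),
    (i = i0 -> psi 0 != 0),
    ((m <= i)%N -> psi = fun s => q i (s ^+ b) * s ^+ (a * (i - m))) &
    ((i < m)%N -> near0 (fun s => q i s = 0) -> psi = fun=> 0)].
  case: (ltnP i m) => im; last first.
    exists (fun s => q i (s ^+ b) * s ^+ (a * (i - m))); split=> //.
    - by apply: analytic0M; [exact: analytic0_comp_exp|apply: analytic0X;
      exact: analytic0_id].
    - exists 1 => // s _; rewrite mulrCA -exprD; congr (_ * _ ^+ _).
      by rewrite -mulnDr subnKC.
    - by move=> ii0; rewrite ii0 leqNgt i0m in im.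
  case: (pselect (near0 (fun s => q i s = 0))) => Zi.
    exists (fun=> 0); split=> //; first exact: analytic0_cst.
      by apply: near0_sub (near_exp _ Zi) => s ->; rewrite mul0r mulr0.
    by move=> ii0; rewrite ii0 in Zi.
  have [u [ua u0 hu]] := hv i Zi.
  have le1 := hmin i im Zi; rewrite -/a -/b in le1.
  (* Minimality of the slope gives a (m - i) <= b v(i), so nothing is truncated in this subtraction.
     For i = i0 the exponent is 0 and the value at 0 is u 0. *)
  exists (fun s => s ^+ (v i * b - a * (m - i)) * u (s ^+ b)); split=> //.
  - apply: analytic0M; first by apply: analytic0X; exact: analytic0_id.
    exact: analytic0_comp_exp.
  - apply: near0_sub (near_exp _ hu) => s ->.
    rewrite mulrA -exprD mulrAC -exprM -exprD; congr (_ ^+ _ * _).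
    rewrite mulnC -{1}(subnK le1) -addnA -mulnDr subnK ?(ltnW im) //.
    by rewrite addnC.
  - move=> ii0; rewrite ii0 /a /b subnn expr0 mul1r expr0n gtn_eqF ?subn_gt0 //.
exists a, b, i0, psi; split=> //; first by rewrite a0.
    by move=> i; case: (hpsi i).
  by case: (hpsi i0) => _ _ /(_ erefl).
by split=> i h; case: (hpsi i) => // _ _ _ h1 h2; [exact: h1|exact: h2].
Qed.

End PolynomialFamilies.

(** * Puiseux branches *)

Section Puiseux.
Variable R : realType.
Local Notation C := R[i].
Local Notation normc := (@Normc.normc R).
Implicit Types (e : R) (s y c : C) (P Q : C -> {poly C}) (E : R -> C -> C -> Prop).

Definition monotone_fam E : Prop :=
  forall e e' s y, e <= e' -> E e s y -> E e' s y.

Definition vanish_on E P : Prop := exists2 e0, 0 < e0 &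
  forall e s y, E e s y -> s != 0 -> normc s <= e0 -> normc y <= e0 ->
  (P s).[y] = 0.

Definition approaches0 E : Prop := forall e, 0 < e ->
  exists s y, [/\ E e s y, s != 0, normc s <= e & normc y <= e].

(** The branch only has to meet each [E e] close to 0, not to lie in it; a sequence of points is
    enough to compare degrees later. *)
Definition has_branch E : Prop := exists b (alpha : C -> C),
  [/\ (0 < b)%N, analytic0 alpha &
    forall e, 0 < e -> exists s,
      [/\ s != 0, normc s <= e & E e (s ^+ b) (alpha s)]].

Lemma has_branch_shift E (tau : C -> C) : analytic0 tau ->
  has_branch (fun e s y => E e s (y + tau s)) -> has_branch E.
Proof.
move=> htau [b [alpha [b0 ha h]]].
exists b, (fun s => alpha s + tau (s ^+ b)); split=> //.
by apply: analytic0D => //; apply: analytic0_comp_exp.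
Qed.

Lemma has_branch_scale E a b : (0 < b)%N ->
  has_branch (fun e s y => E e (s ^+ b) (s ^+ a * y)) -> has_branch E.
Proof.
move=> b0 [b' [alpha [b'0 ha h]]].
exists (b' * b)%N, (fun s => s ^+ (b' * a) * alpha s); split.
- by rewrite muln_gt0 b'0.
- by apply: analytic0M => //; apply: analytic0X; exact: analytic0_id.
- move=> e /h[s [s0 se Es]]; exists s; split=> //.
  by rewrite !exprM.
Qed.

Lemma horner_split n m (p : {poly C}) y : (size p <= n)%N ->
  p.[y] = \sum_(i < m) p`_i * y ^+ i + y ^+ m * (\poly_(j < n) p`_(m + j)).[y].
Proof.
move=> pn; rewrite (horner_coef_wide (n := (m + n)%N)); last first.
  exact: leq_trans pn (leq_addl _ _).
rewrite big_split_ord /=; congr (_ + _).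
rewrite horner_poly mulr_sumr; apply: eq_bigr => i _.
by rewrite exprD mulrCA.
Qed.

(** Cauchy's root bound; [d] is a number rather than a leading coefficient, so that the value of a
    unit cofactor can take its place. *)
Lemma root_bound (m : nat) (f : nat -> C) (d w : C) (M c1 : R) :
  0 <= M -> 0 < c1 -> (forall i, normc (f i) <= M) -> c1 <= normc d ->
  \sum_(i < m.+1) f i * w ^+ i + w ^+ m.+1 * d = 0 ->
  normc w <= 1 + m.+1%:R * M / c1.
Proof.
move=> M0 c10 fM dc h.
have A0 : 0 <= m.+1%:R * M / c1 by rewrite divr_ge0 ?mulr_ge0 // ltW.
case: (leP (normc w) 1) => w1; first by apply: le_trans w1 _; rewrite lerDl.
have w0 : 0 < normc w by apply: lt_trans w1.
apply: (@le_trans _ _ (m.+1%:R * M / c1)); last by rewrite lerDr.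
rewrite ler_pdivlMr // -(ler_pM2l (exprn_gt0 m w0)) mulrA -exprSr.
apply: (@le_trans _ _ (normc (w ^+ m.+1 * d))).
  by rewrite Normc.normcM normcX ler_wpM2l // exprn_ge0 // ltW.
have -> : w ^+ m.+1 * d = - \sum_(i < m.+1) f i * w ^+ i.
  by apply/eqP; rewrite -subr_eq0 opprK addrC h.
rewrite normcN_eq; apply: le_trans (normc_sum _ _ _) _.
apply: (@le_trans _ _ (\sum_(i < m.+1) M * normc w ^+ m)).
  apply: ler_sum => i _; rewrite Normc.normcM normcX.
  apply: ler_pM; rewrite ?normc_ge0 ?exprn_ge0 ?normc_ge0 //.
  by rewrite ler_weXn2l ?(ltW w1) // -ltnS.
by rewrite sumr_const card_ord -[_ *+ m.+1]mulr_natl mulrA mulrC.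
Qed.

(* Why the multiplicity drops: a polynomial of degree [m.+1] without term of degree [m]
   is a [m.+1]-st power of a linear factor only if it is a monomial. *)
Lemma shiftp_low_coef n (p : {poly C}) c m i0 : (size p <= n)%N ->
  (size p <= m.+2)%N -> p`_m = 0 -> p`_m.+1 != 0 -> (i0 < m.+1)%N -> p`_i0 != 0 ->
  exists2 i, (i < m.+1)%N & (shiftp n p c)`_i != 0.
Proof.
move=> pn pm pm0 pm1 i0m pi0; apply: contrapT => h.
have hz i : (i < m.+1)%N -> (p^`N(i)).[c] = 0.
  move=> im; apply/eqP/negPn/negP => hi; apply: h.
  by exists i => //; rewrite coef_shiftp.
have : (p^`N(m)).[c] = 0 by apply: hz.
rewrite (horner_coef_wide (n := 2)); last first.
  apply/leq_sizeP => j j2; rewrite coef_nderivn nth_default ?mul0rn //.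
  by apply: leq_trans pm _; rewrite -addn2 leq_add2l.
rewrite !big_ord_recl big_ord0 !coef_nderivn /= addn0 pm0 mul0rn mul0r add0r addr0.
rewrite expr1 addn1 => /eqP; rewrite mulf_eq0 mulrn_eq0 (negbTE pm1) orbF.
rewrite binSn /= => /eqP c0.
by move/eqP: pi0; apply; have := hz i0 i0m;
  rewrite c0 horner_coef0 coef_nderivn addn0 binn.
Qed.

(** One Newton step after the Tschirnhaus shift. Rescaling y = sigma^a w keeps the points bounded,
    they cluster at a root [c] of [T 0], and the absent term of degree m forces the multiplicity at
    [c] below m+1. *)
Lemma puiseux_step m n Q E :
  (forall m2 n P E', (m2 < m.+1)%N -> analytic_poly n P ->
    (forall i, (i < m2)%N -> (P 0)`_i = 0) -> (P 0)`_m2 != 0 ->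
    monotone_fam E' -> vanish_on E' P -> approaches0 E' -> has_branch E') ->
  analytic_poly n Q -> (forall i, (i < m.+1)%N -> (Q 0)`_i = 0) ->
    (Q 0)`_m.+1 != 0 ->
  near0 (fun s => (Q s)`_m = 0) ->
  monotone_fam E -> vanish_on E Q -> approaches0 E -> has_branch E.
Proof.
move=> IH hQ Q0 Qm Qm' mE [e0 e00 hE] appE.
have mn : (m.+1 < n)%N.
  rewrite ltnNge; apply: contra Qm => nm.
  by rewrite nth_default // (leq_trans (hQ.1 0)).
pose W s := \poly_(j < n) (Q s)`_(m.+1 + j).
have hW : analytic_poly n W.
  split=> [s|i]; first exact: size_poly.
  under eq_fun do rewrite coef_poly.
  by case: (i < n)%N; [exact: hQ.2 | exact: analytic0_cst].
have W0 : (W 0)`_0 != 0 by rewrite coef_poly (leq_ltn_trans _ mn) // addn0.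
have [e1 [c1 [e10 c10 hW1]]] := analytic_poly_nonvanish hW W0.
(* If all lower coefficients vanish, then Q = y^(m+1) W with W nonzero near the origin: the points
   lie on y = 0, which is itself the branch. *)
case: (pselect (forall i, (i < m.+1)%N -> near0 (fun s => (Q s)`_i = 0))) =>
  [Zall|].
  have [e2 e20 he2] := near0_forall Zall.
  exists 1%N, (fun=> 0); split=> // [|e e_gt0]; first exact: analytic0_cst.
  pose e' := Num.min e (Num.min e0 (Num.min e1 e2)).
  have e'0 : 0 < e' by rewrite !lt_min e_gt0 e00 e10.
  have [s [y [Es s0]]] := appE _ e'0.
  rewrite !le_min => /and4P[se se0 se1 se2] /and4P[ye ye0 ye1 ye2].
  exists s; split=> //; rewrite expr1.
  have := hE _ _ _ Es s0 se0 ye0; rewrite (horner_split m.+1 _ (hQ.1 s)) big1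
    => [|i _].
    rewrite add0r -/(W s) => /eqP; rewrite mulf_eq0 expf_eq0 /=.
    have : (W s).[y] != 0 by rewrite -normc_gt0 (lt_le_trans c10) // hW1.
    move=> /negbTE ->; rewrite orbF => /eqP y0.
    by rewrite -y0; apply: mE Es; rewrite ge_min lexx.
  by rewrite he2 // mul0r.
move=> /existsNP[i1 /not_implyP[i1m Z1]].
have [a [b [i0 [psi [/andP[a0 b0] i0m hpsi psi0 [psi_ge psi_Z]]]]]] :=
  @newton_polygon _ m.+1 (fun i s => (Q s)`_i) i1 hQ.2 Q0 i1m Z1.
pose T s := \poly_(i < n) psi i s.
have TE i s : (T s)`_i = psi i s.
  rewrite coef_poly; case: ltnP => // ni; rewrite psi_ge; last first.
    by apply: leq_trans ni; apply: ltnW.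
  by rewrite nth_default ?mul0r // (leq_trans (hQ.1 _)).
have hT : analytic_poly n T.
  split=> [s|i]; first exact: size_poly.
  by under eq_fun do rewrite TE; exact: (hpsi i).1.
have TQ : near0 (fun s => forall w, (T s).[w] * s ^+ (a * m.+1) = (Q (s ^+
  b)).[s ^+ a * w]).
  have := near0_forall (n := n) (fun i _ => (hpsi i).2).
  apply: near0_sub => s hs w.
  rewrite horner_poly (horner_coef_wide _ (hQ.1 _)) mulr_suml.
  apply: eq_bigr => i _; rewrite exprMn mulrA -exprM hs //; ring.
have [e2 e20 hTQ] := TQ.
pose E2 e s w := E e (s ^+ b) (s ^+ a * w).
have le_exp s k : (0 < k)%N -> normc s <= 1 -> normc (s ^+ k) <= normc s.
  move=> k0 s1; rewrite normcX -[leRHS]expr1.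
  by apply: ler_wiXn2l; rewrite ?normc_ge0.
(* The bound on w is left free: it is the root bound when clustering, and 1 + |c| after the shift to
   [c]. Dividing e0 by B + 1 keeps sigma^a w in the region where Q vanishes. *)
have vE2 (B : R) : 0 <= B -> exists2 e3, 0 < e3 & forall e s w, E2 e s w ->
  s != 0 ->
    normc s <= e3 -> normc w <= B -> (T s).[w] = 0.
  move=> B0; have B1 : 0 < B + 1 by rewrite ltr_wpDl.
  exists (Num.min 1 (Num.min e0 (Num.min e2 (e0 / (B + 1))))).
    by rewrite !lt_min ltr01 e00 e20 divr_gt0.
  move=> e s w; rewrite !le_min => Es s0 /and4P[s1 se0 se2 seB] wB.
  have : (Q (s ^+ b)).[s ^+ a * w] = 0.
    apply: hE Es _ _ _; first by rewrite expf_neq0.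
      exact: le_trans (le_exp _ _ b0 s1) se0.
    rewrite Normc.normcM; apply: le_trans (ler_wpM2r (normc_ge0 _) (le_exp _ _
      a0 s1)) _.
    apply: le_trans (ler_wpM2l (normc_ge0 _) wB) _.
    move: seB; rewrite ler_pdivlMr //; apply: le_trans.
    by rewrite ler_wpM2l ?normc_ge0 // lerDl.
  rewrite -hTQ // => /eqP; rewrite mulf_eq0 [X in _ || X]expf_eq0 (negbTE s0)
    andbF orbF.
  by move/eqP.
have [M M0 [e3 e30 hM]] := analytic_poly_bounded hT.
pose B := 1 + m.+1%:R * M / c1.
have B0 : 0 <= B by rewrite addr_ge0 // divr_ge0 ?mulr_ge0 // ltW.
have mE2 : monotone_fam E2 by move=> e e' s y ee; exact: mE.
have T0 : T 0 != 0.
  apply/eqP => h; have := TE m.+1 0; rewrite h coef0 psi_ge //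
    subnn muln0 expr0 mulr1.
  by rewrite expr0n gtn_eqF // => /esym/eqP; rewrite (negbTE Qm).
have appE2 e : 0 < e -> exists s w, [/\ E2 e s w, s != 0,
  normc s <= e & normc w <= B].
  move=> e_gt0; pose f := Num.min e (Num.min 1 (Num.min e3 e2)).
  have f0 : 0 < f by rewrite !lt_min e_gt0 ltr01 e30.
  (* With |s| <= f^b, any b-th root of s has modulus at most f. *)
  pose e' := Num.min e (Num.min (f ^+ b) (Num.min e0 e1)).
  have e'0 : 0 < e' by rewrite !lt_min e_gt0 exprn_gt0 // e00.
  have [s [y [Es s0]]] := appE _ e'0.
  rewrite !le_min => /and4P[se sf se0 se1] /and4P[ye yf ye0 ye1].
  have [sg hsg] : exists sg, sg ^+ b = s by exists (b.-root s); rewrite rootCK.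
  have sg0 : sg != 0 by apply: contra s0 => /eqP h; rewrite -hsg h expr0n gtn_eqF.
  have sgf : normc sg <= f.
    rewrite -(@ler_pXn2r _ b) ?nnegrE ?normc_ge0 ?(ltW f0) //.
    by rewrite -normcX hsg.
  move: (sgf); rewrite !le_min => /and4P[sge sg1 sge3 sge2].
  pose w := y / sg ^+ a.
  have yw : sg ^+ a * w = y by rewrite /w mulrCA divff ?mulr1 // expf_neq0.
  exists sg, w; split=> //.
    by rewrite /E2 hsg yw; apply: mE Es; rewrite ge_min lexx.
  have Tw : (T sg).[w] = 0.
    apply: (mulIf (x := sg ^+ (a * m.+1))); first by rewrite expf_neq0.
    by rewrite mul0r hTQ // hsg yw; apply: hE Es s0 se0 ye0.
  (* The terms of T(sg, w) of degree at least m+1 add up to w^(m+1) W(s, y), and |W| >= c1. *)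
  apply: (@root_bound m (fun i => (T sg)`_i) ((W s).[y])) => //.
  - by move=> i; apply: hM.
  - exact: hW1.
  rewrite -[RHS]Tw (horner_split m.+1 _ (hT.1 sg)); congr (_ + _ * _).
  rewrite !horner_poly; apply: eq_bigr => i _.
  rewrite TE psi_ge ?leq_addr // hsg addKn -yw exprMn exprM mulrA //.
have [e4 e40 hE2] := vE2 B B0.
have [c hc] := cluster_root hT T0 mE2 e40 hE2 appE2.
(* Above degree m+1 a positive power of sigma remains, so [T 0] has degree exactly m+1. *)
have psi0E i : (m.+1 < i)%N -> psi i 0 = 0.
  move=> im; rewrite psi_ge ?(ltnW im) // [0 ^+ (a * _)]expr0n muln_eq0 subn_eq0.
  by rewrite gtn_eqF // leqNgt im /= mulr0.
have sT : (size (T 0%R) <= m.+2)%N.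
  by apply/leq_sizeP => j jm; rewrite TE psi0E.
have Tm1 : (T 0)`_m.+1 != 0.
  by rewrite TE psi_ge // subnn muln0 expr0 mulr1 expr0n gtn_eqF.
have Tm : (T 0)`_m = 0 by rewrite TE psi_Z.
have Ti0 : (T 0)`_i0 != 0 by rewrite TE.
have [i im hi] := shiftp_low_coef c (hT.1 0) sT Tm Tm1 i0m Ti0.
pose P s := shiftp n (T s) c.
have exm : exists i, (P 0)`_i != 0 by exists i.
case: (ex_minnP exm) => m2 Pm2 m2min.
have m2m : (m2 < m.+1)%N by apply: leq_ltn_trans (m2min i hi) im.
apply: (@has_branch_scale _ a b b0); apply: (@has_branch_shift _ (fun=> c)).
  exact: analytic0_cst.
apply: (IH m2 n P) => //.
- exact: analytic_poly_shiftp hT (analytic0_cst c).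
- move=> j jm2; apply/eqP/negPn/negP => /m2min.
  by rewrite leqNgt jm2.
- by move=> e e' s y ee; exact: mE.
- have [e5 e50 h5] := vE2 (1 + normc c) (addr_ge0 ler01 (normc_ge0 c)).
  exists (Num.min 1 e5); first by rewrite lt_min ltr01.
  move=> e s y Es s0; rewrite !le_min => /andP[_ se5] /andP[y1 _].
  rewrite horner_shiftp ?hT.1 // addrC; apply: h5 Es s0 se5 _.
  by apply: le_trans (normcD_le _ _) _; rewrite lerD2r.
- move=> e e_gt0; have [s [y [Es s0 se yc]]] := hc e e_gt0.
  by exists s, (y - c); split=> //; rewrite subrK.
Qed.

(** Induction on the multiplicity [m] of the root 0 of [P 0]. For m = 0 there are no zeros near the
    origin for the points to approach. Otherwise the derivative of order m - 1 has a simple root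
    there, to which the variable is shifted. *)
Lemma puiseux_branch m n P E : analytic_poly n P ->
  (forall i, (i < m)%N -> (P 0)`_i = 0) -> (P 0)`_m != 0 ->
  monotone_fam E -> vanish_on E P -> approaches0 E -> has_branch E.
Proof.
elim/ltn_ind: m n P E => -[|m] IH n P E hP P0 Pm mE vE appE.
  case: vE => e0 e00 hE; have [e1 [c [e10 c0 h]]] := analytic_poly_nonvanish hP Pm.
  have e2 : 0 < Num.min e0 e1 by rewrite lt_min e00.
  have [s [y [Es s0]]] := appE _ e2.
  rewrite !le_min => /andP[s1 s2] /andP[y1 y2].
  have := h s y s2 y2; rewrite (hE _ _ _ Es s0 s1 y1) Normc.normc0 leNgt.
  by rewrite c0.
have [||tau [htau tau0 hroot]] := @analytic_simple_root _ n (fun s => (P s)^`N(m))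
    (analytic_poly_nderiv m hP).
- by rewrite coef_nderivn addn0 P0 // mul0rn.
- by rewrite coef_nderivn addn1 binSn mulrn_eq0 /=.
(* Tschirnhaus shift: [tau] being a root of the [m]-th derivative, the
   coefficient of degree [m] vanishes identically afterwards. *)
apply: (has_branch_shift htau).
pose Q s := shiftp n (P s) (tau s).
have Q0E i : (Q 0)`_i = (P 0)`_i by rewrite /Q tau0 coef_shiftp0 // hP.1.
apply: (@puiseux_step m n Q) => //.
- by move=> m2 n' P' E' m2m; apply: IH.
- exact: analytic_poly_shiftp hP htau.
- by move=> i im; rewrite Q0E P0.
- by rewrite Q0E.
- by apply: near0_sub hroot => s; rewrite coef_shiftp // hP.1.
- by move=> e e' s y ee; exact: mE.
- case: vE => e0 e00 hE; have e20 : 0 < e0 / 2 by rewrite divr_gt0.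
  have [e1 e10 h1] := analytic0_cont htau e20.
  exists (Num.min e1 (e0 / 2)); first by rewrite lt_min e10.
  move=> e s y Es s0; rewrite !le_min => /andP[s1 s2] /andP[_ y2].
  rewrite horner_shiftp ?hP.1 // addrC; apply: hE Es s0 _ _; first by lra.
  apply: le_trans (normcD_le _ _) _.
  have := h1 s s1; rewrite tau0 subr0; lra.
- move=> e e_gt0; have e20 : 0 < e / 2 by rewrite divr_gt0.
  have [e1 e10 h1] := analytic0_cont htau e20.
  have e3 : 0 < Num.min e1 (e / 2) by rewrite lt_min e10.
  have [s [y [Es s0]]] := appE _ e3.
  rewrite !le_min => /andP[s1 s2] /andP[y1 y2].
  exists s, (y - tau s); split=> //.
  + by rewrite subrK; apply: mE Es; rewrite ge_min; apply/orP; right; lra.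
  + by lra.
  + apply: le_trans (normcD_le _ _) _; rewrite normcN_eq.
    have := h1 s s1; rewrite tau0 subr0; lra.
Qed.

End Puiseux.

(** * Branches of algebraic curves at infinity *)

Section PolynomialBranch.
Variable R : realType.
Local Notation C := R[i].
Local Notation normc := (@Normc.normc R).
Implicit Types (e : R) (s x y c : C) (p : {poly C}) (g h : {poly {poly C}}).

Lemma large_nonroot p : p != 0 -> exists B : R, forall y, B < normc y -> p.[y] != 0.
Proof.
move=> p0; have [rs prs] := closed_field_poly_normal p.
exists (\sum_(z <- rs) normc z) => y hy.
rewrite prs hornerZ mulf_eq0 lead_coef_eq0 (negbTE p0) /=.
rewrite -[_ == 0]/(root _ y) root_prod_XsubC; apply: contraL hy => yrs.
rewrite -leNgt (perm_big _ (perm_to_rem yrs)) big_cons /= lerDl.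
by apply: sumr_ge0 => z _; apply: normc_ge0.
Qed.

Lemma seq_argmin (T : eqType) (f : T -> R) (z0 : T) (l : seq T) : z0 \in l ->
  exists2 z, z \in l & forall t : T, t \in l -> f z <= f t.
Proof.
case: l => // a l _; elim: l a => [|b l IH] a.
  by exists a; rewrite ?mem_head // => x; rewrite inE => /eqP ->.
have [z zl hz] := IH b.
case: (leP (f a) (f z)) => az; [exists a|exists z]; rewrite ?mem_head //.
- move=> x; rewrite inE => /predU1P[->//|/hz]; exact: le_trans.
- by rewrite inE zl orbT.
- by move=> x; rewrite inE => /predU1P[->|/hz//]; exact: ltW.
Qed.

(* Moving [y] to the nearest root of [p] at most doubles its distance to any
   root of a divisor of [p]. *)
Lemma nearest_root p y : p.[0] = 0 -> exists z, [/\ p.[z] = 0,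
  normc z <= 2 * normc y &
  forall q, q %| p -> normc q.[z] <= 2 ^+ size q * normc q.[y]].
Proof.
move=> p00; have [->|p0] := eqVneq p 0.
  exists y; split; rewrite ?horner0 //.
    by rewrite ler_peMl ?normc_ge0 // ler1n.
  by move=> q _; rewrite ler_peMl ?normc_ge0 // exprn_ege1 // ler1n.
have [rs prs] := closed_field_poly_normal p.
have rootP z : (z \in rs) = (p.[z] == 0).
  by rewrite prs hornerZ mulf_eq0 lead_coef_eq0 (negbTE p0) /= -[X in _ =
    X]/(root _ z) root_prod_XsubC.
have rs0 : 0 \in rs by rewrite rootP p00.
have [z zrs hz] := seq_argmin (fun z => normc (y - z)) rs0.
exists z; split; first by apply/eqP; rewrite -rootP.
  have := hz 0 rs0; rewrite subr0 => h1.
  have -> : z = y - (y - z) by ring.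
  apply: le_trans (normcD_le _ _) _; rewrite normcN_eq; lra.
move=> q qp; have q0 : q != 0 by apply: contraNneq p0 => q0; rewrite q0 dvd0p in qp.
have [ts qts] := closed_field_poly_normal q.
have tsrs t : t \in ts -> t \in rs.
  move=> tt; rewrite rootP -[_ == 0]/(root p t); apply: (root_dvdp qp).
  by rewrite qts rootE hornerZ mulf_eq0 -[X in _ || X]/(root _ t)
    root_prod_XsubC tt orbT.
have sq : (size ts <= size q)%N.
  by rewrite qts size_scale ?lead_coef_eq0 // size_prod_XsubC.
apply: (@le_trans _ _ (2 ^+ size ts * normc q.[y])); last first.
  by rewrite ler_wpM2r ?normc_ge0 // ler_weXn2l // ler1n.
rewrite qts !hornerZ !Normc.normcM mulrCA ler_wpM2l ?normc_ge0 //.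
elim: (ts) tsrs => [|t l IH] tsrs.
  by rewrite !big_nil !hornerC Normc.normc1 expr0 mul1r.
rewrite !big_cons !hornerM !hornerE !Normc.normcM /= exprS mulrACA.
apply: ler_pM; rewrite ?normc_ge0 //; last first.
  by apply: IH => u ul; apply: tsrs; rewrite inE ul orbT.
have h1 := hz t (tsrs _ (mem_head _ _)).
have -> : z - t = (y - t) - (y - z) by ring.
apply: le_trans (normcD_le _ _) _; rewrite normcN_eq; lra.
Qed.

Lemma horner2_ev h y x : h.[y, x] = (map_poly (horner_eval x) h).[y].
Proof.
have := horner_map (horner_eval x) h y%:P.
by rewrite /= /horner_eval hornerC => ->.
Qed.

(** The chart x = 1/s with ratio coordinate y, in which points whose moving coordinate is O(|x|)
    stay bounded. The power s^M clears all denominators, as i < n and j < N. *)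
Lemma analytic_poly_at_infty h : h != 0 -> exists n M (P : C -> {poly C}),
  [/\ analytic_poly n P, exists i, ~ near0 (fun s => (P s)`_i = 0) &
   forall s y, s != 0 -> (P s).[y] = s ^+ M * h.[y / s, s^-1]].
Proof.
move=> h0; pose n := size h; pose N := sizeY h; pose M := (n + N)%N.
pose c i s := \sum_(j < N) h`_i`_j * s ^+ (M - i - j).
pose P s := \poly_(i < n) c i s.
have cE i s : (i < n)%N -> s != 0 -> c i s = s ^+ M * ((h`_i).[s^-1] / s ^+ i).
  move=> ni s0; rewrite (horner_coef_wide _ (max_size_coefXY h i)) mulr_suml
    mulr_sumr.
  apply: eq_bigr => j _.
  have -> : s ^+ M = s ^+ (M - i - j) * s ^+ j * s ^+ i.
    rewrite -!exprD -subnDA addnAC -addnA subnK // leq_add //; first exact: ltnW.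
    exact: ltnW.
  have si : s ^+ i != 0 by rewrite expf_neq0.
  have sj : s ^+ j != 0 by rewrite expf_neq0.
  rewrite exprVn; move: (s ^+ (M - i - j)) (s ^+ j) (s ^+ i) si sj => u v w w0 v0.
  by field; rewrite w0 v0.
exists n, M, P; split.
- split=> [s|i]; first exact: size_poly.
  have : analytic0 (fun s => if (i < n)%N then c i s else 0).
    case: (i < n)%N; last exact: analytic0_cst.
    by apply: analytic0_sum => j _; apply: analytic0M;
      [exact: analytic0_cst|apply: analytic0X; exact: analytic0_id].
  by congr analytic0; apply/funext => s; rewrite coef_poly.
- exists n.-1; have n0 : (n.-1 < n)%N by rewrite prednK // size_poly_gt0.
  have hl : h`_n.-1 != 0 by rewrite -lead_coefE lead_coef_eq0.
  have [B hB] := large_nonroot hl => -[e e0 he].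
  (* Large enough to avoid the roots of the leading coefficient and to put 1/x in the ball where
     that coefficient is assumed to vanish. *)
  pose x := (Num.max (B + 1) (Num.max 1 e^-1))%:C : C.
  have nx : normc x = Num.max (B + 1) (Num.max 1 e^-1).
    by rewrite normc_real ger0_norm // !le_max ler01 orbT.
  have x0 : x != 0 by rewrite -normc_gt0 nx !lt_max ltr01 orbT.
  have := he x^-1; rewrite Normc.normcV nx coef_poly n0 cE ?invr_eq0 // invrK.
  move=> /(_ _) h1; have /eqP : x^-1 ^+ M * ((h`_n.-1).[x] / x^-1 ^+ n.-1) = 0.
    apply: h1; rewrite -[leRHS]invrK lef_pV2 ?posrE ?invr_gt0 //.
      by rewrite !le_max lexx !orbT.
    by rewrite !lt_max ltr01 orbT.
  rewrite !mulf_eq0 invr_eq0 !expf_eq0 invr_eq0 (negbTE x0) !andbF /= orbF.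
  apply/negP; apply: hB; rewrite nx lt_max ltrDl ltr01 //.
- move=> s y s0; rewrite horner_poly horner2_ev.
  rewrite (horner_coef_wide (n := n)); last exact: size_poly.
  rewrite mulr_sumr; apply: eq_bigr => i _.
  by rewrite cE // coef_map /= horner_evalE expr_div_n -!mulrA [_^-1 * _]mulrC.
Qed.

(** Dividing by the least order of vanishing of the coefficients makes the family nonzero at s = 0,
    as [cluster_root] requires. *)
Lemma analytic_poly_normalize n (P : C -> {poly C}) : analytic_poly n P ->
  (exists i, ~ near0 (fun s => (P s)`_i = 0)) ->
  exists v Q, [/\ analytic_poly n Q, Q 0 != 0 & near0 (fun s =>
    P s = s ^+ v *: Q s)].
Proof.
move=> hP [i1 Z1]; pose Z i := ~ near0 (fun s => (P s)`_i = 0).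
have /choice[v hv] i : exists v, Z i -> exists u,
    [/\ analytic0 u, u 0 != 0 & near0 (fun s => (P s)`_i = s ^+ v * u s)].
  case: (analytic0_order (hP.2 i)) => [h|[k [u hu]]]; first by exists 0%N => /(_ h).
  by exists k => _; exists u.
have ex : exists k, `[< exists i, Z i /\ v i = k >].
  by exists (v i1); apply/asboolP; exists i1.
case: (ex_minnP ex) => k /asboolP[i0 [Zi0 vi0]] kmin.
have /choice[psi hpsi] i : exists psi, [/\ analytic0 psi,
    near0 (fun s => (P s)`_i = s ^+ k * psi s) & (i = i0 -> psi 0 != 0)].
  case: (pselect (near0 (fun s => (P s)`_i = 0))) => Zi.
    exists (fun=> 0); split=> //; first exact: analytic0_cst.
      by apply: near0_sub Zi => s ->; rewrite mulr0.
    by move=> ii0; rewrite ii0 in Zi.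
  have [u [ua u0 hu]] := hv i Zi.
  have kv : (k <= v i)%N by apply: kmin; apply/asboolP; exists i.
  exists (fun s => s ^+ (v i - k) * u s); split=> //.
  - by apply: analytic0M => //; apply: analytic0X; exact: analytic0_id.
  - by apply: near0_sub hu => s ->; rewrite mulrA -exprD subnKC.
  - by move=> ii0; rewrite ii0 vi0 subnn expr0 mul1r.
have i0n : (i0 < n)%N.
  rewrite ltnNge; apply/negP => ni; apply: Zi0; exists 1 => // s _.
  by rewrite nth_default // (leq_trans (hP.1 s)).
pose Q s := \poly_(i < n) psi i s.
exists k, Q; split.
- split=> [s|i]; first exact: size_poly.
  have : analytic0 (fun s => if (i < n)%N then psi i s else 0).
    by case: (i < n)%N; [case: (hpsi i)|exact: analytic0_cst].
  by congr analytic0; apply/funext => s; rewrite coef_poly.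
- apply/eqP => /(congr1 (fun p : {poly C} => p`_i0)); rewrite coef0 coef_poly i0n.
  by apply/eqP; case: (hpsi i0) => _ _; apply.
- have hk i : (i < n)%N -> near0 (fun s => (P s)`_i = s ^+ k * psi i s).
    by case: (hpsi i).
  have := near0_forall hk.
  apply: near0_sub => s hs; apply/polyP => i; rewrite coefZ coef_poly.
  case: ltnP => ni; first exact: hs.
  by rewrite mulr0 nth_default // (leq_trans (hP.1 s)).
Qed.

(** Bounded points cluster at some (0, c). Translating [c] to 0 gives a root of finite multiplicity
    because [Q 0] is nonzero, and the local statement applies. *)
Lemma analytic_poly_cluster_branch n P (E : R -> C -> C -> Prop) (B : R) :
  analytic_poly n P -> (exists i, ~ near0 (fun s => (P s)`_i = 0)) ->
  monotone_fam E ->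
  (forall e s y, E e s y -> s != 0 -> (P s).[y] = 0) ->
  (forall e, 0 < e -> exists s y, [/\ E e s y, s != 0,
    normc s <= e & normc y <= B]) ->
  has_branch E.
Proof.
move=> hP nzP mE hE appE.
have [v [Q [hQ Q0 [e0 e00 hQP]]]] := analytic_poly_normalize hP nzP.
have hEQ e s y : E e s y -> s != 0 -> normc s <= e0 -> (Q s).[y] = 0.
  move=> Es s0 se; have := hE e s y Es s0; rewrite hQP // hornerZ => /eqP.
  by rewrite mulf_eq0 expf_eq0 (negbTE s0) andbF => /eqP.
have hEB e s y : E e s y -> s != 0 -> normc s <= e0 -> normc y <= B ->
    (Q s).[y] = 0.
  by move=> Es s0 se _; apply: hEQ Es s0 se.
have [c hc] := cluster_root hQ Q0 mE e00 hEB appE.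
apply: (@has_branch_shift _ _ (fun=> c)); first exact: analytic0_cst.
pose T s := shiftp n (Q s) c.
have [B' hB] := large_nonroot Q0.
have exT : exists i, (T 0)`_i != 0.
  pose x := (Num.max (B' + 1) 0)%:C : C.
  apply: contrapT => /forallNP hT.
  have : (T 0).[x - c] = 0.
    suff -> : T 0 = 0 by rewrite horner0.
    by apply/polyP => i; rewrite coef0; have /negP/negPn/eqP := hT i.
  rewrite horner_shiftp ?hQ.1 // addrC subrK; apply/eqP; apply: hB.
  by rewrite normc_real ger0_norm ?le_max ?lexx ?orbT // lt_max ltrDl ltr01.
case: (ex_minnP exT) => m Tm mmin.
apply: (@puiseux_branch _ m n T) => //.
- exact: analytic_poly_shiftp hQ (analytic0_cst c).
- by move=> i im; apply/eqP/negPn/negP => /mmin; rewrite leqNgt im.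
- by move=> e e' s y ee; exact: mE.
- exists e0 => // e s y Es s0 se _.
  by rewrite horner_shiftp ?hQ.1 // addrC; apply: hEQ Es s0 se.
- move=> e e_gt0; have [s [y [Es s0 se ye]]] := hc e e_gt0.
  by exists s, (y - c); split=> //; rewrite subrK.
Qed.

(** The outer variable y is moved while x is fixed, so the right-hand sides, which depend on |x|
    alone, do not change. *)
Lemma polynomial_branch (g1 g2 g3 : {poly {poly C}}) (nu : R) :
  (forall e, 0 < e -> exists y x, [/\ e^-1 <= normc x, normc y <= normc x,
     normc g1.[y, x] <= e, normc g2.[y, x] <= normc x `^ nu &
     normc g3.[y, x] <= normc x `^ nu]) ->
  exists b (u : C -> C) (K : R), [/\ (0 < b)%N, analytic0 u, 0 <= K &
    forall e, 0 < e -> exists s, [/\ s != 0, normc s <= e &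
      let x := s ^- b in let y := u s * x in
      [/\ normc g1.[y, x] <= K * e, normc g2.[y, x] <= K * normc x `^ nu &
          normc g3.[y, x] <= K * normc x `^ nu]]].
Proof.
move=> happ.
(* A zero factor would make [h] zero; its own estimate holds trivially. *)
pose nz g : {poly {poly C}} := if g == 0 then 1 else g.
(* The factor 'X makes 0 a root for every x, so that the nearest root z satisfies |z| <= 2 |y|. *)
pose h := 'X * (nz g1 * (nz g2 * nz g3)).
have nz0 g : nz g != 0 by rewrite /nz; have [_|//] := eqVneq g 0; rewrite oner_eq0.
have h0 : h != 0 by rewrite !mulf_neq0 // polyX_eq0.
pose K : R := 2 ^+ (size g1 + size g2 + size g3).
have K0 : 0 <= K by rewrite exprn_ge0.
pose ev x g : {poly C} := map_poly (horner_eval x) g.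
have evM x : {morph ev x : p q / p * q} by move=> p q; apply: rmorphM.
pose E e s Y := [/\ h.[Y / s, s^-1] = 0, normc g1.[Y / s, s^-1] <= K * e,
  normc g2.[Y / s, s^-1] <= K * normc s^-1 `^ nu &
  normc g3.[Y / s, s^-1] <= K * normc s^-1 `^ nu].
have [n [M [P [hP nzP PE]]]] := analytic_poly_at_infty h0.
suff [b [u [b0 ua hu]]] : has_branch E.
  exists b, u, K; split=> // e /hu[s [s0 se [_ E1 E2 E3]]].
  by exists s; split.
(* The bound 2 comes from |z| <= 2 |y| <= 2 |x|. *)
apply: (@analytic_poly_cluster_branch n P E 2) => //.
- move=> e e' s y ee [E0 E1 E2 E3]; split=> //.
  by apply: le_trans E1 _; rewrite ler_wpM2l.
- by move=> e s y [E0 _ _ _] s0; rewrite PE // E0 mulr0.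
move=> e e0; have [y [x [xe yx y1 y2 y3]]] := happ e e0.
have nx : 0 < normc x by apply: lt_le_trans xe; rewrite invr_gt0.
have x0 : x != 0 by rewrite -normc_gt0.
have [|z [z0 zy hz]] := @nearest_root (ev x h) y.
  by rewrite evM /ev map_polyX hornerM hornerX mul0r.
have hg g : ev x (nz g) %| ev x h -> (size g <= size g1 + size g2 + size g3)%N ->
    normc g.[z, x] <= K * normc g.[y, x].
  rewrite /nz; case: eqVneq => [->|_] hd sg.
    by rewrite horner2_ev !horner2_ev rmorph0 !horner0 Normc.normc0 mulr0.
  rewrite !horner2_ev; apply: le_trans (hz _ hd) _.
  rewrite ler_wpM2r ?normc_ge0 // ler_weXn2l ?ler1n //.
  by apply: leq_trans sg; apply: size_poly.
have d1 : ev x (nz g1) %| ev x h by rewrite !evM dvdp_mull // dvdp_mulr.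
have d2 : ev x (nz g2) %| ev x h by rewrite !evM dvdp_mull // dvdp_mull //
  dvdp_mulr.
have d3 : ev x (nz g3) %| ev x h by rewrite !evM dvdp_mull // dvdp_mull //
  dvdp_mull.
exists x^-1, (z / x); rewrite /E invrK mulfVK //; split.
- split; first by rewrite horner2_ev.
  + apply: le_trans (hg g1 d1 _) _; first by rewrite -addnA leq_addr.
    by rewrite ler_wpM2l.
  + apply: le_trans (hg g2 d2 _) _; first by rewrite addnAC leq_addl.
    by rewrite ler_wpM2l.
  + apply: le_trans (hg g3 d3 _) _; first by rewrite leq_addl.
    by rewrite ler_wpM2l.
- by rewrite invr_eq0.
- by rewrite Normc.normcV -[leRHS]invrK lef_pV2 ?posrE ?invr_gt0.
- rewrite Normc.normcM Normc.normcV ler_pdivrMr //; apply: le_trans zy _.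
  by rewrite ler_wpM2l.
Qed.

End PolynomialBranch.

(** * Laurent series at infinity and degrees *)

Section Laurent.
Variable R : realType.
Local Notation C := R[i].
Local Notation normc := (@Normc.normc R).
Implicit Types (e : R) (s t c : C) (phi psi : C -> C) (h : C -> R).

Definition near_infty (Q : C -> Prop) : Prop :=
  exists2 rho : R, 0 < rho & forall t, rho < normc t -> Q t.

Lemma near_infty_and (Q1 Q2 : C -> Prop) : near_infty Q1 -> near_infty Q2 ->
  near_infty (fun t => Q1 t /\ Q2 t).
Proof.
move=> [e1 e10 h1] [e2 e20 h2]; exists (Num.max e1 e2).
  by rewrite lt_max e10.
by move=> s; rewrite gt_max => /andP[/h1 ? /h2 ?].
Qed.

Lemma near_infty_sub (Q1 Q2 : C -> Prop) : (forall s, Q1 s -> Q2 s) ->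
  near_infty Q1 -> near_infty Q2.
Proof. by move=> h [e e0 h1]; exists e => // s /h1 /h. Qed.

Lemma near_infty_inv (Q : C -> Prop) : near0 Q -> near_infty (fun t => Q t^-1).
Proof.
move=> [e e0 h]; exists e^-1; first by rewrite invr_gt0.
move=> t et; apply: h; rewrite Normc.normcV -[leRHS]invrK ltW //.
by rewrite ltf_pV2 // posrE ?invr_gt0 // (lt_trans _ et) ?invr_gt0.
Qed.

Lemma near_infty_gt (B : R) : near_infty (fun t => B < normc t).
Proof.
exists (Num.max 1 B); first by rewrite lt_max ltr01.
by move=> t; rewrite gt_max => /andP[].
Qed.

Lemma near_infty_ex (Q : C -> Prop) : near_infty Q -> exists t, Q t.
Proof.
move=> [r r0 h]; exists (r + 1)%:C; apply: h.
by rewrite normc_real ger0_norm ?addr_ge0 ?(ltW r0) // ltrDl.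
Qed.

Lemma cvg_ccvg (u : nat -> C) (l : C) :
  (u : nat -> C^o) @ \oo --> (l : C^o) <-> ccvg u l.
Proof.
split=> [/cvgrPdist_le h e e0|h].
  have e0' : 0 < e%:C :> C^o by rewrite ltcR.
  have [N _ hN] := h _ e0'.
  exists N => n /hN /=; rewrite normr_normc lecR.
  by rewrite normc_distC.
apply/cvgrPdist_le => e; rewrite ltcE => /andP[/eqP /= eI eR].
have [N hN] := h _ eR; exists N => // n /hN; rewrite normc_distC.
by rewrite -lecR -normr_normc => h1; rewrite [e]complexE eI mulr0 addr0.
Qed.

Lemma ccvg_bounded (u : nat -> C) l : ccvg u l ->
  exists2 B : R, 0 <= B & forall n, normc (u n) <= B.
Proof.
move=> /(_ 1 ltr01) [N hN].
pose B := normc l + 1 + \sum_(i < N) normc (u i).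
have S0 : 0 <= \sum_(i < N) normc (u i) by apply: sumr_ge0 => i _; exact: normc_ge0.
exists B; first by rewrite !addr_ge0 ?normc_ge0.
move=> n; case: (leqP N n) => Nn.
  have -> : u n = l + (u n - l) by ring.
  apply: le_trans (normcD_le _ _) _; rewrite /B -[leLHS]addr0.
  by apply: lerD => //; rewrite lerD2l; apply: hN.
rewrite /B (bigD1 (Ordinal Nn)) //= addrCA lerDl !addr_ge0 ?normc_ge0 //.
by apply: sumr_ge0 => i _; exact: normc_ge0.
Qed.

Lemma laurent_psum (c : int -> C) (k : int) t : t != 0 ->
  (series (fun j : nat => c (k - j%:Z) * t ^ (k - j%:Z)) : nat -> C) =
  fun n => t ^ k * psum (fun j : nat => c (k - j%:Z)) n t^-1.
Proof.
move=> t0; apply/funext => n; rewrite /series /= big_mkord mulr_sumr.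
apply: eq_bigr => j _; rewrite mulrCA; congr (_ * _).
by rewrite expfzDr // exprVn -exprnN.
Qed.

(** Abel's argument: convergence at |t| = 2r bounds the terms there, and at half the corresponding
    radius 1/(2r) in s = 1/t they are dominated by a geometric series. *)
Lemma laurent_bps phi (c : int -> C) : laurent_at_infty phi c ->
  exists (k : int) r M u, [/\ 0 < r, bpsc r M (fun j : nat => c (k - j%:Z)) u,
    (forall m, k < m -> c m = 0) &
    near_infty (fun t => phi t = t ^ k * u t^-1)].
Proof.
move=> [k [ck [r r0 hr]]].
pose a (j : nat) := c (k - j%:Z).
have hcv t : r < normc t -> ccvg (fun n => psum a n t^-1) (phi t / t ^ k).
  move=> rt; have t0 : t != 0 by rewrite -normc_gt0 (lt_trans r0).
  have /cvg_ccvg := hr t rt; rewrite laurent_psum // => /(ccvgZ (t ^ k)^-1).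
  rewrite mulrC; congr ccvg; apply/funext => n.
  by rewrite mulKf // expfz_neq0.
pose rho := (2 * r)^-1.
have rho0 : 0 < rho by rewrite invr_gt0 mulr_gt0.
have [B B0 hB] : exists2 B : R, 0 <= B & forall j, normc (a j) * rho ^+ j <= B.
  pose t : C := (2 * r)%:C.
  have nt : normc t = 2 * r by rewrite normc_real ger0_norm // mulr_ge0 // ltW.
  have rt : r < normc t by rewrite nt; lra.
  have [B B0 hB] := ccvg_bounded (hcv t rt).
  exists (2 * B); first by rewrite mulr_ge0.
  move=> j; have -> : normc (a j) * rho ^+ j = normc (psum a j.+1 t^-1 - psum a
    j t^-1).
    rewrite psumS addrAC subrr add0r Normc.normcM normcX Normc.normcV nt //.
  apply: le_trans (normcD_le _ _) _; rewrite normcN_eq.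
  by have := hB j; have := hB j.+1; lra.
pose u s := if s == 0 then a 0%N else phi s^-1 * s ^ k.
pose r' := rho / 2.
have r'0 : 0 < r' by rewrite divr_gt0.
exists k, r', (2 * B), u; split=> //; last first.
  exists r => // t rt; have t0 : t != 0 by rewrite -normc_gt0 (lt_trans r0).
  rewrite /u invr_eq0 (negbTE t0) invrK mulrCA -expfzMl divff //.
  by rewrite exp1rz mulr1.
apply: (@bpsc_series _ r' (2 * B) (fun k => normc (a k) * r' ^+ k)
  (fun k i => if i == k then a k else 0) (fun k s => a k * s ^+ k)) => //.
- by move=> j; exact: bpsc_monom.
- move=> K; apply: (@le_trans _ _ (\sum_(k < K) B * 2^-1 ^+ k)).
    by apply: ler_sum => j _; rewrite /r' exprMn mulrA ler_wpM2r.
  have -> : \sum_(k < K) B * 2^-1 ^+ k = 2 * B * (1 - 2^-1 ^+ K).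
    elim: K => [|K IHK]; first by rewrite big_ord0 expr0 subrr mulr0.
    by rewrite big_ord_recr IHK /= exprS; set x := 2^-1 ^+ K; lra.
  by rewrite ler_piMr ?mulr_ge0 // gerBl exprn_ge0 // invr_ge0.
- move=> n e e0; exists n.+1 => K nK; rewrite (bigD1 (Ordinal nK)) //= eqxx.
  rewrite big1 => [|i ni]; first by rewrite addr0 subrr Normc.normc0 ltW.
  by case: eqP => // ni'; rewrite -val_eqE /= ni' eqxx in ni.
- move=> s sr; rewrite /u; have [->|s0] := eqVneq s 0.
    move=> e e0; exists 1%N => -[//|K] _.
    rewrite big_ord_recl expr0 mulr1 big1 ?addr0 ?subrr ?Normc.normc0 ?(ltW e0) //.
    by move=> i _; rewrite expr0n mulr0.
  have rs : r < normc s^-1.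
    rewrite Normc.normcV -[ltLHS]invrK ltf_pV2 ?posrE ?invr_gt0 ?normc_gt0 //.
    apply: le_lt_trans sr _; rewrite /r' /rho.
    rewrite invfM mulrC mulrA gtr_pMl ?invr_gt0 //; lra.
  by have := hcv _ rs; rewrite invrK exprz_inv invr_expz opprK.
Qed.

Lemma bps_laurent phi r M (a : nat -> C) u (k : int) : 0 < r -> bpsc r M a u ->
  near_infty (fun t => phi t = t ^ k * u t^-1) ->
  laurent_at_infty phi (fun m => if m <= k then a `|k - m|%N else 0).
Proof.
move=> r0 hu hphi; set c := (fun m : int => _).
exists k; split=> [m km|]; first by rewrite /c leNgt km.
have [rho rho0 h] := near_infty_and hphi (near_infty_gt r^-1).
exists rho => // t rt; have [-> rt'] := h t rt.
have t0 : t != 0 by rewrite -normc_gt0 (lt_trans rho0).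
apply/cvg_ccvg; rewrite laurent_psum //; apply: ccvgZ.
have -> : (fun j : nat => c (k - j%:Z)) = a.
  by apply/funext => j; rewrite /c lerBlDr lerDl /= subKr.
apply: (bpsc_cvg r0 hu).
by rewrite Normc.normcV -[ltRHS]invrK ltf_pV2 ?posrE ?invr_gt0 ?normc_gt0.
Qed.

(** The degree read off from the size of the function: this form determines [m] and passes to
    maxima, hence to vectors. *)
Definition growth h (m : int) : Prop := exists c1 c2 : R, [/\ 0 < c1, 0 < c2 &
  near_infty (fun t => c1 * normc t ^ m <= h t <= c2 * normc t ^ m)].

Lemma growth_unit phi u (k : int) : analytic0 u -> u 0 != 0 ->
  near_infty (fun t => phi t = t ^ k * u t^-1) ->
  growth (fun t => normc (phi t)) k.
Proof.
move=> ua u0 h; have [M hM] := analytic0_bounded ua.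
have u0' : 0 < normc (u 0) by rewrite normc_gt0.
exists (normc (u 0) / 2), (Num.max 1 M); split.
- by rewrite divr_gt0.
- by rewrite lt_max ltr01.
have := near_infty_and h (near_infty_inv (near0_and (analytic0_neq0 ua u0) hM)).
apply: near_infty_sub => t [-> [h1 h2]].
rewrite Normc.normcM normcXz [normc t ^ k * _]mulrC.
have tk : 0 <= normc t ^ k by rewrite exprz_ge0 // normc_ge0.
by rewrite !ler_wpM2r //= le_max h2 orbT.
Qed.

Lemma laurent_lead phi (c : int -> C) : laurent_at_infty phi c ->
  ((forall m, c m = 0) /\ near_infty (fun t => phi t = 0)) \/
  exists m, [/\ c m != 0, forall m', m < m' -> c m' = 0 &
    growth (fun t => normc (phi t)) m].
Proof.
move=> /laurent_bps[k [r [M [u [r0 hu ck hphi]]]]].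
have cE m : m <= k -> c m = c (k - (`|k - m|%N)%:Z).
  by move=> mk; rewrite gez0_abs ?subr_ge0 // subKr.
case: (pselect (exists n : nat, c (k - n%:Z) != 0)) => [an|a0].
  right; have [n [v [cn cn' va v0 uv]]] := bpsc_order r0 hu an.
  exists (k - n%:Z); split=> // [m' nm'|].
    case: (leP m' k) => m'k; last exact: ck.
    rewrite cE //; apply: cn'; rewrite -ltz_nat gez0_abs ?subr_ge0 //.
    by rewrite ltrBlDl addrC -ltrBlDl.
  apply: (growth_unit va); first by rewrite v0.
  apply: near_infty_sub (near_infty_and hphi (near_infty_gt 0)) => t [-> t0].
  rewrite uv mulrA expfzDr; last by rewrite -normc_gt0.
  by rewrite exprVn -exprnN.
left; have a0' n : c (k - n%:Z) = 0.
  by apply/eqP/negPn/negP => h; apply: a0; exists n.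
split=> [m|].
  by case: (leP m k) => mk; [rewrite cE|apply: ck].
have r20 : 0 < r / 2 by rewrite divr_gt0.
have h0 : near0 (fun s => u s = 0).
  exists (r / 2) => // s sr; apply: (bpsc_eq0 r0 hu a0').
  by apply: le_lt_trans sr _; lra.
by apply: near_infty_sub (near_infty_and hphi (near_infty_inv h0)) => t [->
  ->]; rewrite mulr0.
Qed.

(** Arbitrarily large x suffice, which is how estimates along a sequence control a degree. If a > b,
    the inequality fails once x^(a-b) >= |c2|/c1 + 1. *)
Lemma powR_exponent_le (a b c1 c2 : R) : 0 < c1 ->
  (forall B, exists2 x, B < x & c1 * x `^ a <= c2 * x `^ b) -> a <= b.
Proof.
move=> c10 h; rewrite leNgt; apply/negP => ba.
have d0 : 0 < a - b by rewrite subr_gt0.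
have A0 : 0 <= `|c2| / c1 + 1 by rewrite addr_ge0 // divr_ge0 // ltW.
have [x Bx] := h (Num.max 1 ((`|c2| / c1 + 1) `^ (a - b)^-1)).
move: Bx; rewrite gt_max => /andP[x1 xB].
have x0 : 0 < x by apply: lt_trans x1.
have xb : 0 < x `^ b by rewrite powR_gt0.
have -> : a = (a - b) + b by ring.
rewrite powRD; last by apply/implyP => _; rewrite gt_eqF.
rewrite mulrA ler_pM2r //; apply/negP; rewrite -ltNge.
apply: (@lt_le_trans _ _ (c1 * (`|c2| / c1 + 1))).
  rewrite mulrDr mulr1 mulrCA divff ?gt_eqF // mulr1.
  by have := ler_norm c2; lra.
rewrite ler_pM2l //.
have : (`|c2| / c1 + 1) `^ (a - b)^-1 `^ (a - b) <= x `^ (a - b).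
  by apply: ge0_ler_powR; rewrite ?nnegrE ?powR_ge0 ?ltW.
by rewrite -powRrM mulVf ?gt_eqF // powRr1.
Qed.

Lemma growth_unique h m m' : growth h m -> growth h m' -> m = m'.
Proof.
have half n n' : growth h n -> growth h n' -> n <= n'.
  move=> [c1 [c2 [c10 c20 h1]]] [c1' [c2' [c10' c20' h2]]].
  rewrite -(@ler_int R); apply: (@powR_exponent_le _ _ c1 c2' c10) => B.
  have [t [[ha hb] Bt]] := near_infty_ex (near_infty_and (near_infty_and h1 h2)
    (near_infty_gt B)).
  exists (normc t) => //; rewrite !powR_intmul ?normc_ge0 //.
  by move: ha hb => /andP[ha _] /andP[_ hb]; apply: le_trans ha hb.
by move=> h1 h2; apply/eqP; rewrite eq_le !half.
Qed.

Lemma growth_neq0 h m : growth h m -> ~ near_infty (fun t => h t = 0).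
Proof.
move=> [c1 [c2 [c10 c20 h1]]] h2.
have [t [[ha hb] t0]] := near_infty_ex (near_infty_and (near_infty_and h1 h2)
  (near_infty_gt 0)).
move: ha; rewrite hb => /andP[]; rewrite leNgt mulr_gt0 //.
by rewrite exprz_gt0.
Qed.

Definition has_degree h (d : \bar R) : Prop :=
  (d = -oo%E /\ near_infty (fun t => h t = 0)) \/
  exists m : int, d = (m%:~R)%:E /\ growth h m.

(** The supremum in [deg] runs over all expansions; [growth_unique] gives them the same leading
    exponent, which is all that is used of the uniqueness of coefficients. *)
Lemma deg_spec phi : meromorphic_at_infty phi ->
  has_degree (fun t => normc (phi t)) (deg phi).
Proof.
move=> [c hc]; case: (laurent_lead hc) => [[c0 phi0]|[m [cm cm' gm]]]; [left|right].
  split; last by apply: near_infty_sub phi0 => t ->; rewrite Normc.normc0.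
  rewrite /deg; set S := [set m : int | _].
  have -> : S = set0; last by rewrite image_set0 ereal_sup0.
  apply/seteqP; split=> // m [c' hc' cm'].
  case: (laurent_lead hc') => [[c0' _]|[m2 [_ _ /growth_neq0]]].
    by move/eqP: cm'; apply.
  by apply; apply: near_infty_sub phi0 => t ->; rewrite Normc.normc0.
exists m; split=> //; rewrite /deg; apply/eqP; rewrite eq_le; apply/andP; split.
  apply: ge_ereal_sup => _ [m2 [c' hc' cm2] <-].
  rewrite lee_fin ler_int.
  case: (laurent_lead hc') => [[c0' _]|[m3 [_ hm3 gm3]]].
    by rewrite c0' eqxx in cm2.
  rewrite (growth_unique gm gm3) leNgt; apply: contra cm2 => /hm3 ->.
  exact: eqxx.
by apply: ereal_sup_ubound; exists m => //; exists c.
Qed.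

(** A negative leading exponent is absorbed into [u], so a natural power of t is enough for the
    closure properties. *)
Lemma meromorphicP phi : meromorphic_at_infty phi <->
  exists (k : nat) u, analytic0 u /\ near_infty (fun t => phi t = t ^+ k * u t^-1).
Proof.
split=> [[c /laurent_bps[k [r [M [u [r0 hu _ hphi]]]]]]|].
  have ua : analytic0 u by exists r, M; split=> //; eexists; exact: hu.
  case: k hu hphi => k hu hphi; first by exists k, u; split.
  exists 0%N, (fun s => s ^+ k.+1 * u s); split.
    by apply: analytic0M => //; apply: analytic0X; exact: analytic0_id.
  by apply: near_infty_sub hphi => t ->; rewrite expr0 mul1r NegzE -exprnN exprVn.
move=> [k [u [[r [M [r0 [a ha]]]] hphi]]].
by eexists; apply: (bps_laurent (k := k) r0 ha); exact: hphi.
Qed.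

Lemma meromorphic_cst c : meromorphic_at_infty (fun=> c).
Proof.
apply/meromorphicP; exists 0%N, (fun=> c); split; first exact: analytic0_cst.
by exists 1 => // t _; rewrite expr0 mul1r.
Qed.

Lemma meromorphicD phi psi : meromorphic_at_infty phi -> meromorphic_at_infty psi ->
  meromorphic_at_infty (fun t => phi t + psi t).
Proof.
move=> /meromorphicP[k [u [ua hu]]] /meromorphicP[l [v [va hv]]].
apply/meromorphicP; exists (k + l)%N, (fun s => s ^+ l * u s + s ^+ k * v s); split.
  by apply: analytic0D; apply: analytic0M => //; apply: analytic0X;
    exact: analytic0_id.
apply: near_infty_sub (near_infty_and (near_infty_and hu hv) (near_infty_gt 0)).
move=> t [[-> ->]]; rewrite normc_gt0 => t0.
have tk : t ^+ k != 0 by rewrite expf_neq0.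
have tl : t ^+ l != 0 by rewrite expf_neq0.
rewrite exprD !exprVn mulrDr; congr (_ + _).
  by rewrite -mulrA mulVKf.
by rewrite mulrAC -!mulrA mulVKf // mulrC.
Qed.

Lemma meromorphicM phi psi : meromorphic_at_infty phi -> meromorphic_at_infty psi ->
  meromorphic_at_infty (fun t => phi t * psi t).
Proof.
move=> /meromorphicP[k [u [ua hu]]] /meromorphicP[l [v [va hv]]].
apply/meromorphicP; exists (k + l)%N, (fun s => u s * v s); split.
  exact: analytic0M.
by apply: near_infty_sub (near_infty_and hu hv) => t [-> ->]; rewrite exprD mulrACA.
Qed.

Lemma meromorphic_horner (p : {poly C}) phi : meromorphic_at_infty phi ->
  meromorphic_at_infty (fun t => p.[phi t]).
Proof.
move=> h; elim/poly_ind: p => [|p c IH].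
  by under eq_fun do rewrite horner0; exact: meromorphic_cst.
under eq_fun do rewrite hornerMXaddC.
by apply: meromorphicD; [exact: meromorphicM|exact: meromorphic_cst].
Qed.

Lemma meromorphic_horner2 (f : {poly {poly C}}) phi psi :
  meromorphic_at_infty phi -> meromorphic_at_infty psi ->
  meromorphic_at_infty (fun t => f.[phi t, psi t]).
Proof.
move=> h1 h2; elim/poly_ind: f => [|f p IH].
  by under eq_fun do rewrite !horner0; exact: meromorphic_cst.
under eq_fun do rewrite hornerMXaddC hornerD hornerM hornerC.
by apply: meromorphicD; [exact: meromorphicM|exact: meromorphic_horner].
Qed.

Lemma has_degree_max h1 h2 d1 d2 : (forall t, 0 <= h1 t) -> (forall t, 0 <= h2 t) ->
  has_degree h1 d1 -> has_degree h2 d2 ->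
  has_degree (fun t => Num.max (h1 t) (h2 t)) (Order.max d1 d2).
Proof.
move=> h10 h20 [[-> z1]|[m1 [-> g1]]] [[-> z2]|[m2 [-> g2]]].
- left; rewrite maxxx; split=> //.
  by apply: near_infty_sub (near_infty_and z1 z2) => t [-> ->]; rewrite maxxx.
- right; exists m2; rewrite maxNye; split=> //; move: g2 => [c1 [c2 [c10 c20 h]]].
  exists c1, c2; split=> //; apply: near_infty_sub (near_infty_and z1 h).
  by move=> t [-> ?]; rewrite (max_idPr _).
- right; exists m1; rewrite maxeNy; split=> //; move: g1 => [c1 [c2 [c10 c20 h]]].
  exists c1, c2; split=> //; apply: near_infty_sub (near_infty_and z2 h).
  by move=> t [-> ?]; rewrite (max_idPl _).
have key k1 k2 l1 l2 : k1 <= k2 -> growth l1 k1 -> growth l2 k2 ->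
    growth (fun t => Num.max (l1 t) (l2 t)) k2.
  move=> kk [c1 [c2 [c10 c20 h]]] [c1' [c2' [c10' c20' h']]].
  exists c1', (Num.max c2 c2'); split=> //; first by rewrite lt_max c20.
  apply: near_infty_sub (near_infty_and (near_infty_and h h') (near_infty_gt 1)).
  move=> t [[/andP[_ ha] /andP[hb hc]] t1]; rewrite le_max hb orbT /=.
  have t0 : 0 <= normc t ^ k2 by rewrite exprz_ge0 // normc_ge0.
  rewrite ge_max; apply/andP; split.
    apply: le_trans ha _; apply: ler_pM;
      rewrite ?(ltW c20) ?exprz_ge0 ?normc_ge0 //.
      by rewrite le_max lexx.
    by apply: ler_weXz2l => //; exact: ltW.
  by apply: le_trans hc _; rewrite ler_wpM2r // le_max lexx orbT.
right; rewrite -EFin_max; case: (leP m1 m2) => mm.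
  exists m2; rewrite (max_idPr _) ?ler_int //; split=> //; exact: key mm g1 g2.
exists m1; rewrite (max_idPl _) ?ler_int ?(ltW mm) //; split=> //.
by have := key _ _ _ _ (ltW mm) g2 g1; congr growth; apply/funext => t;
  rewrite maxC.
Qed.

Lemma maxnorm2 (z : 'rV[C]_2) :
  maxnorm z = Num.max (normc (z 0 0)) (normc (z 0 1)).
Proof.
rewrite /maxnorm !big_ord_recl big_ord0 (max_idPl (normc_ge0 _)).
by congr (Num.max _ (normc (z 0 _))); apply/val_inj.
Qed.

Lemma degv_spec (Phi : C -> 'rV[C]_2) :
  (forall i, meromorphic_at_infty (fun t => Phi t 0 i)) ->
  has_degree (fun t => maxnorm (Phi t)) (degv Phi).
Proof.
move=> h; rewrite /degv big_ord_recl big_ord1.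
under eq_fun do rewrite maxnorm2.
have -> : lift ord0 ord0 = 1 :> 'I_2 by apply/val_inj.
by apply: has_degree_max => [t|t||]; rewrite ?normc_ge0 //; apply: deg_spec.
Qed.

End Laurent.

(** * The two inequalities *)

Section LojasiewiczExponents.
Variable R : realType.
Local Notation C := R[i].
Local Notation normc := (@Normc.normc R).
Implicit Types (f : {poly {poly C}}) (t : C) (delta nu : R).

Lemma loj_anti n m (F : 'rV[C]_n -> 'rV[C]_m) (S S' : set 'rV[C]_n) :
  S `<=` S' -> (loj F S' <= loj F S)%E.
Proof.
move=> SS; apply: ge_ereal_sup => _ [nu [A [B [A0 B0 h]]] <-].
apply: ereal_sup_ubound; exists nu => //; exists A, B; split=> // z Sz.
by apply: h; apply: SS.
Qed.

(** Smaller discs give larger exponents, so the limit at 0+ is a supremum. *)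
Lemma loj_near_sup f (l0 : C) : loj_near f l0 =
  ereal_sup [set loj (grad f) (eval2 f @^-1` disc l0 delta) |
             delta in [set` `]0, +oo[ ]].
Proof.
apply: cvg_lim => //; apply: nonincreasing_at_right_cvge => // d d' _ _ dd.
by apply: loj_anti => z; rewrite /disc /= => h; apply: lt_le_trans dd.
Qed.

Lemma le_ereal_fin_above (x y : \bar R) :
  (forall r : R, (x < r%:E)%E -> (y <= r%:E)%E) -> (y <= x)%E.
Proof.
case: x => [r| |] h; last 2 first.
- exact: leey.
- case: y h => [s| |] h //.
    by have := h (s - 1)%R (ltNyr _); rewrite lee_fin leNgt ltrBlDr ltrDl ltr01.
  by have := h 0%R (ltNyr _).
by apply/lee_addgt0Pr => e e0; apply: h; rewrite lte_fin ltrDl.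
Qed.

Lemma maxnorm_grad f z : maxnorm (grad f z) =
  Num.max (normc f^`().[z 0 0, z 0 1]) (normc (map_poly deriv f).[z 0 0, z 0 1]).
Proof. by rewrite maxnorm2 !mxE. Qed.

Lemma grad_meromorphic f (Phi : C -> 'rV[C]_2) :
  (forall i, meromorphic_at_infty (fun t => Phi t 0 i)) ->
  forall i, meromorphic_at_infty (fun t => (grad f \o Phi) t 0 i).
Proof.
move=> h i; under eq_fun do rewrite /= mxE /eval2.
exact: meromorphic_horner2.
Qed.

Lemma eval2_meromorphic f (l0 : C) (Phi : C -> 'rV[C]_2) :
  (forall i, meromorphic_at_infty (fun t => Phi t 0 i)) ->
  meromorphic_at_infty (fun t => eval2 f (Phi t) - l0).
Proof.
move=> h; apply: meromorphicD; last exact: meromorphic_cst.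
exact: meromorphic_horner2.
Qed.

Lemma growth_neg_small (h : C -> R) m e : growth h m -> m < 0 -> 0 < e ->
  near_infty (fun t => h t < e).
Proof.
move=> [c1 [c2 [c10 c20 hg]]] m0 e0.
apply: near_infty_sub (near_infty_and (near_infty_and hg (near_infty_gt 1))
  (near_infty_gt (c2 / e))) => t [[/andP[_ ht] t1] te].
apply: le_lt_trans ht _; have t0 : 0 < normc t by apply: lt_trans t1.
have : normc t ^ m <= normc t ^ (-1).
  by apply: ler_weXz2l; [exact: ltW|rewrite -ltzD1 addNr].
rewrite exprN1 => h1; apply: le_lt_trans (ler_wpM2l (ltW c20) h1) _.
by rewrite ltr_pdivrMr // mulrC -ltr_pdivrMr.
Qed.

(** The sign of [nu] decides which endpoint gives the smaller power; the minimum covers both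
    cases. *)
Lemma powR_between (a b M nu : R) : 0 < a -> a <= M -> M <= b ->
  Num.min (a `^ nu) (b `^ nu) <= M `^ nu.
Proof.
move=> a0 aM Mb; have M0 := lt_le_trans a0 aM; have b0 := lt_le_trans M0 Mb.
rewrite ge_min; case: (leP 0 nu) => nu0.
  by apply/orP; left; apply: ge0_ler_powR; rewrite ?nnegrE ?(ltW a0) ?(ltW M0).
apply/orP; right; have p0 : 0 <= - nu by rewrite oppr_ge0 ltW.
rewrite -[nu]opprK; move: (- nu) p0 => p p0.
rewrite !powRN lef_pV2 ?posrE ?powR_gt0 //.
by apply: ge0_ler_powR; rewrite ?nnegrE ?(ltW M0) ?(ltW b0).
Qed.

Lemma has_degree_le h d (m : int) (nu c : R) : (forall t, 0 <= h t) ->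
  has_degree h d ->
  0 < m -> (forall B : R, exists2 t, B < normc t & h t <= c * (normc t ^ m) `^
    nu) ->
  (d / (m%:~R)%:E <= nu%:E)%E.
Proof.
move=> h0 hd m0 hB; have m0' : 0 < m%:~R :> R by rewrite ltr0z.
rewrite inver gt_eqF //; case: hd => [[-> _]|[n [-> [c1 [c2 [c10 c20 hg]]]]]].
  by rewrite gt0_mulNye ?leNye // lte_fin invr_gt0.
rewrite lee_pdivrMr // -EFinM lee_fin.
apply: (@powR_exponent_le _ _ _ c1 c c10) => B.
have [rho rho0 hr] := hg; have [t] := hB (Num.max B rho).
rewrite gt_max => /andP[tB /hr /andP[h1 _] h2]; exists (normc t) => //.
rewrite [nu * _]mulrC powRrM !powR_intmul ?normc_ge0 //.
exact: le_trans h1 h2.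
Qed.

Lemma loj_le_param f (l0 : C) (Phi : C -> 'rV[C]_2) delta : 0 < delta ->
  (forall i, meromorphic_at_infty (fun t => Phi t 0 i)) ->
  (0 < degv Phi)%E -> (deg (fun t => eval2 f (Phi t) - l0)%R < 0)%E ->
  (loj (grad f) (eval2 f @^-1` disc l0 delta) <= degv (grad f \o Phi) / degv Phi)%E.
Proof.
move=> d0 hPhi degPhi degf; apply: ge_ereal_sup => _ [nu [A [B [A0 B0 hAB]]] <-].
case: (degv_spec hPhi) => [[h _]|[m [hm gm]]]; first by rewrite h in degPhi.
have m0 : 0 < m by move: degPhi; rewrite hm lte_fin ltr0z.
have m0' : 0 < m%:~R :> R by rewrite ltr0z.
have fsmall : near_infty (fun t => disc l0 delta (eval2 f (Phi t))).
  case: (deg_spec (eval2_meromorphic f l0 hPhi)) => [[_ h]|[k [hk gk]]].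
    by apply: near_infty_sub h => t; rewrite /disc /= => ->.
  apply: growth_neg_small gk _ d0.
  by move: degf; rewrite hk lte_fin ltrz0.
have [c1 [c2 [c10 c20 hc]]] := gm.
have large : near_infty (fun t => B < maxnorm (Phi t)).
  apply: near_infty_sub (near_infty_and (near_infty_and hc (near_infty_gt 1))
    (near_infty_gt (B / c1))) => t [[/andP[h1 _] t1]].
  rewrite ltr_pdivrMr // mulrC => h2; apply: lt_le_trans h2 (le_trans _ h1).
  rewrite ler_wpM2l ?(ltW c10) // -[leLHS]expr1z.
  by apply: ler_weXz2l => //; exact: ltW.
pose c := Num.min (c1 `^ nu) (c2 `^ nu).
have c0 : 0 < c by rewrite lt_min !powR_gt0.
have key : near_infty (fun t => A * c * (normc t ^ m) `^ nu <= maxnorm (grad f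
  (Phi t))).
  apply: near_infty_sub (near_infty_and (near_infty_and fsmall large)
    (near_infty_and hc (near_infty_gt 0))) => t [[ft tB] [/andP[h1 h2] t0]].
  apply: le_trans (hAB _ ft tB); rewrite -mulrA ler_wpM2l ?(ltW A0) //.
  have tm : 0 < normc t ^ m by rewrite exprz_gt0.
  apply: le_trans (powR_between nu _ h1 h2); last by rewrite mulr_gt0.
  rewrite !powRM ?(ltW tm) ?(ltW c10) ?(ltW c20) //.
  by rewrite minr_pMl ?powR_ge0 // /c.
rewrite hm inver gt_eqF //.
(* A gradient vanishing along [Phi] would contradict the positive lower bound [key]. *)
case: (degv_spec (grad_meromorphic f hPhi)) => [[_ h]|[k [->
  [k1 [k2 [k10 k20 gk]]]]]].
  have [t [[ht h'] t0]] := near_infty_ex (near_infty_and (near_infty_and h key)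
    (near_infty_gt 0)).
  move: h'; rewrite /= in ht; rewrite ht leNgt !mulr_gt0 //.
  by rewrite powR_gt0 // exprz_gt0.
rewrite lee_pdivlMr // -EFinM lee_fin.
apply: (@powR_exponent_le _ _ _ (A * c) k2) => [|B1]; first by rewrite mulr_gt0.
have [t [[h1 /andP[_ h2]] tB]] := near_infty_ex (near_infty_and (near_infty_and
  key gk) (near_infty_gt B1)).
exists (normc t) => //; rewrite [nu * _]mulrC powRrM !powR_intmul ?normc_ge0 //.
exact: le_trans h1 h2.
Qed.

Lemma loj_near_le_param f (l0 : C) : (loj_near f l0 <= loj_param f l0)%E.
Proof.
rewrite loj_near_sup; apply: ge_ereal_sup => _ [delta /= d0 <-].
apply: le_ereal_inf_tmp => _ [Phi [h1 h2 h3] <-].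
by apply: loj_le_param => //; move: d0; rewrite in_itv /= andbT.
Qed.

(** The hypotheses concern isolated points of the curve; meromorphy turns them into statements about
    degrees. *)
Lemma loj_param_le f (l0 : C) (Phi : C -> 'rV[C]_2) (b : nat) (K nu : R) :
  (0 < b)%N -> 0 <= K ->
  (forall i, meromorphic_at_infty (fun t => Phi t 0 i)) ->
  growth (fun t => maxnorm (Phi t)) b ->
  (forall e, 0 < e -> exists t, [/\ e^-1 <= normc t,
     normc (eval2 f (Phi t) - l0) <= K * e &
     maxnorm (grad f (Phi t)) <= K * (normc t ^+ b) `^ nu]) ->
  (loj_param f l0 <= nu%:E)%E.
Proof.
move=> b0 K0 hPhi gb happ.
have hd : degv Phi = ((b%:Z)%:~R)%:E.
  case: (degv_spec hPhi) => [[_ h]|[m [-> gm]]]; first by case: (growth_neq0 gb).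
  by rewrite (growth_unique gb gm).
have bz : 0 < b%:Z by rewrite ltz_nat.
have freq (B : R) : exists2 e, 0 < e & forall t, e^-1 <= normc t -> B < normc t.
  exists (Num.max 1 (B + 1))^-1; first by rewrite invr_gt0 lt_max ltr01.
  by move=> t; rewrite invrK ge_max => /andP[_]; apply: lt_le_trans; rewrite ltrDl.
apply: le_trans (_ : (degv (grad f \o Phi) / degv Phi <= _)%E).
  apply: ereal_inf_lbound; exists Phi => //; split=> //.
    by rewrite hd lte_fin ltr0z.
  case: (deg_spec (eval2_meromorphic f l0 hPhi)) => [[-> _]|[m [->
    [c1 [c2 [c10 _ [rho rho0 hg]]]]]]].
    exact: ltNy0.
  (* A degree m >= 0 would keep |f - l0| at least c1 for large t, whereas e' makes K e' at most
     c1/2. *)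
  rewrite lte_fin ltrz0 ltNge; apply/negP => m0.
  have [e e0 he] := freq (Num.max 1 rho).
  have K1 : 0 < K + 1 by rewrite ltr_wpDl.
  pose e' := Num.min e (c1 / (2 * (K + 1))).
  have e'0 : 0 < e' by rewrite lt_min e0 divr_gt0 // mulr_gt0.
  have [t [te tf _]] := happ e' e'0.
  have : Num.max 1 rho < normc t.
    apply: he; apply: le_trans te; rewrite lef_pV2 ?posrE //.
    by rewrite ge_min lexx.
  rewrite gt_max => /andP[t1 /hg /andP[h1 _]].
  have tm : 1 <= normc t ^ m.
    by rewrite -[leLHS](expr0z (normc t)); apply: ler_weXz2l => //; exact: ltW.
  have : c1 <= K * e'.
    apply: le_trans tf; apply: le_trans h1.
    by rewrite ler_peMr // ltW.
  apply/negP; rewrite -ltNge.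
  apply: (@le_lt_trans _ _ ((K + 1) * (c1 / (2 * (K + 1))))).
    apply: ler_pM => //; rewrite ?(ltW e'0) ?lerDl //.
    by rewrite ge_min lexx orbT.
  have -> : (K + 1) * (c1 / (2 * (K + 1))) = c1 / 2 by field; rewrite gt_eqF.
  lra.
rewrite hd; apply: (has_degree_le _ (degv_spec (grad_meromorphic f hPhi)) bz)
  => [t|B].
  by rewrite maxnorm2 le_max normc_ge0.
have [e e0 he] := freq B; have [t [te _ tg]] := happ e e0.
by exists t; [exact: he|exact: tg].
Qed.

Lemma growth_max_exp (u : C -> C) b : analytic0 u ->
  growth (fun t => Num.max (normc (t ^+ b)) (normc (u t^-1 * t ^+ b))) b.
Proof.
move=> ua; have [M hM] := analytic0_bounded ua.
exists 1, (Num.max 1 M); split; rewrite ?lt_max ?ltr01 //.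
apply: near_infty_sub (near_infty_inv hM) => t ht.
rewrite mul1r -exprnP normcX le_max lexx /= Normc.normcM normcX ge_max.
have tb : 0 <= normc t ^+ b by rewrite exprn_ge0 // normc_ge0.
rewrite ler_peMl ?le_max ?lexx // ler_wpM2r //.
by rewrite le_max ht orbT.
Qed.

(* [mk y x] is the point with root coordinate [y] and parameter coordinate [x],
   put back in the order of the variables of [f]. *)
Lemma loj_param_le_branch f (l0 : C) (g1 g2 g3 : {poly {poly C}}) (nu : R)
    (mk : C -> C -> 'rV[C]_2) :
  (forall y x, eval2 f (mk y x) - l0 = g1.[y, x]) ->
  (forall y x, maxnorm (grad f (mk y x)) =
     Num.max (normc g2.[y, x]) (normc g3.[y, x])) ->
  (forall y x, maxnorm (mk y x) = Num.max (normc x) (normc y)) ->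
  (forall i, (forall y x, mk y x 0 i = x) \/ (forall y x, mk y x 0 i = y)) ->
  (forall e, 0 < e -> exists y x, [/\ normc y <= normc x, e^-1 <= normc x,
     normc g1.[y, x] <= e &
     Num.max (normc g2.[y, x]) (normc g3.[y, x]) <= normc x `^ nu]) ->
  (loj_param f l0 <= nu%:E)%E.
Proof.
move=> hE hG hM hC happ.
have [|b [u [K [b0 ua K0 hs]]]] := @polynomial_branch _ g1 g2 g3 nu.
  move=> e /happ[y [x [yx ex h1]]]; rewrite ge_max => /andP[h2 h3].
  by exists y, x; split.
pose Phi t := mk (u t^-1 * t ^+ b) (t ^+ b).
apply: (@loj_param_le f l0 Phi b K nu) => //.
- move=> i; apply/meromorphicP; exists b.
  case: (hC i) => h; [exists (fun=> 1)|exists u]; split=> //.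
  + exact: analytic0_cst.
  + by exists 1 => // t _; rewrite /Phi h mulr1.
  + by exists 1 => // t _; rewrite /Phi h mulrC.
- have := growth_max_exp b ua; congr growth; apply/funext => t.
  by rewrite hM.
- move=> e /hs[s [s0 se [h1 h2 h3]]]; exists s^-1.
  have sb : s^-1 ^+ b = s ^- b by rewrite exprVn.
  split.
  + rewrite Normc.normcV lef_pV2 ?posrE ?normc_gt0 //.
    by apply: lt_le_trans se; rewrite normc_gt0.
  + by rewrite hE invrK sb.
  + by rewrite hG invrK -normcX sb ge_max h2 h3.
Qed.

Lemma loj_param_le_near f (l0 : C) : (loj_param f l0 <= loj_near f l0)%E.
Proof.
apply: le_ereal_fin_above => nu hnu.
pose pt e (z : 'rV[C]_2) := [/\ e^-1 <= maxnorm z,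
  normc (eval2 f z - l0) <= e & maxnorm (grad f z) <= maxnorm z `^ nu].
(* Without such a point, [nu] would be an admissible exponent on the disc of radius e, with A = 1
   and B = 1/e, against the choice of [nu] above the supremum. *)
have hpt e : 0 < e -> exists z, pt e z.
  move=> e0; apply: contrapT => /forallNP hz.
  move: hnu; apply/negP; rewrite -leNgt loj_near_sup.
  apply: le_trans (ereal_sup_ubound _); last first.
    by exists e => //=; rewrite in_itv /= andbT.
  apply: ereal_sup_ubound; exists nu => //; exists 1, e^-1.
  split; rewrite ?invr_gt0 // => z zS ze; rewrite mul1r leNgt; apply/negP => gz.
  by apply: (hz z); split; rewrite ?ltW //; exact: ltW zS.
have mk0 (x y : C) : (\row_(i < 2) (if i == 0 then x else y)) 0 0 = x by
  rewrite mxE.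
have mk1 (x y : C) : (\row_(i < 2) (if i == 0 then x else y)) 0 1 = y by
  rewrite mxE.
have hl (x y : C) : (f - l0%:P%:P).[x, y] = f.[x, y] - l0.
  by rewrite hornerD hornerN !hornerC hornerD hornerN hornerC.
(* A dichotomy instead of a subsequence: either every precision has a point with |y| <= |x|, or from
   some precision e1 on all points have |x| <= |y|. *)
case: (pselect (forall e, 0 < e -> exists2 z,
  pt e z & normc (z 0 1) <= normc (z 0 0))).
  (* Here y has to move, so [swapXY] makes it the outer variable; in the other case x is already
     outer. *)
  move=> hz; apply: (@loj_param_le_branch f l0 (swapXY (f - l0%:P%:P))
    (swapXY f^`()) (swapXY (map_poly deriv f)) nu
    (fun y x => \row_i (if i == 0 then x else y))) =>
      [y x|y x|y x|i|e /hz[z [h1 h2 h3] h4]].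
  - by rewrite /eval2 mk0 mk1 horner2_swapXY hl.
  - by rewrite maxnorm_grad mk0 mk1 !horner2_swapXY.
  - by rewrite maxnorm2 mk0 mk1.
  - by case: (eqVneq i 0) => [->|/negbTE i0]; [left|right] => y x; rewrite mxE ?i0.
  exists (z 0 1), (z 0 0); move: h1 h2 h3.
  rewrite maxnorm_grad maxnorm2 (max_idPl h4) !horner2_swapXY hl.
  by split.
move=> /existsNP[e1 /not_implyP[e10 he1]].
apply: (@loj_param_le_branch f l0 (f - l0%:P%:P) f^`() (map_poly deriv f) nu
    (fun y x => \row_i (if i == 0 then y else x))) => [y x|y x|y x|i|e e0].
- by rewrite /eval2 mk0 mk1 hl.
- by rewrite maxnorm_grad mk0 mk1.
- by rewrite maxnorm2 mk0 mk1 maxC.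
- by case: (eqVneq i 0) => [->|/negbTE i0]; [right|left] => y x; rewrite mxE ?i0.
have e20 : 0 < Num.min e e1 by rewrite lt_min e0.
have [z [h1 h2 h3]] := hpt _ e20.
have eE : e^-1 <= (Num.min e e1)^-1 by rewrite lef_pV2 ?posrE // ge_min lexx.
have e1E : e1^-1 <= (Num.min e e1)^-1 by rewrite lef_pV2 ?posrE // ge_min lexx orbT.
have h4 : normc (z 0 0) <= normc (z 0 1).
  rewrite leNgt; apply/negP => lt; apply: he1; exists z; last exact: ltW.
  split=> //; first exact: le_trans e1E h1.
  by apply: le_trans h2 _; rewrite ge_min lexx orbT.
exists (z 0 0), (z 0 1); move: h1 h2 h3.
rewrite maxnorm_grad maxnorm2 (max_idPr h4) hl => h1 h2 h3; split=> //.
  exact: le_trans eE h1.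
by apply: le_trans h2 _; rewrite ge_min lexx.
Qed.

End LojasiewiczExponents.

Theorem theorem5p1 (R : realType) (f : {poly {poly R[i]}}) (lambda0 : R[i])
  (hf : ~ exists c : R[i], f = c%:P%:P) :
  loj_near f lambda0 = loj_param f lambda0.
Proof.
by apply/eqP; rewrite eq_le loj_near_le_param loj_param_le_near.
Qed.
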